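(* Let $g$ be the Kac-Moody algebra associated to a symmetrizable Cartan matrix of affine or indefinite type, and let $\lambda,\mu$ be dominant weights. Put $U(\lambda,\mu)=L(\lambda)\otimes L^*(\mu)$, regarded as a $U_q(g)$-module. Then $$\mathrm{End}_{U_q(g)}\,U(\lambda,\mu)\cong \mathbb{Q}(q).$$ Hence $U(\lambda,\mu)$ is absolutely indecomposable.
   Context: The base field is $K=\mathbb{Q}(q)$. Let $\alpha_1,\dots,\alpha_n$ be the simple roots of $g$, with the invariant bilinear form $(\cdot,\cdot)$ on weights normalized so that the integral weight lattice is an even integral lattice. $U_q(g)$ is the quantized enveloping algebra, generated over $K$ by $E_i,F_i,K_i,K_i^{-1}$ ($1\le i\le n$) with the usual relations in which $q$ is replaced by $q^2$: the $K_i^{\pm1}$ commute, $K_iE_jK_i^{-1}=q^{2(\alpha_i,\alpha_j)}E_j$, $K_iF_jK_i^{-1}=q^{-2(\alpha_i,\alpha_j)}F_j$, $[E_i,F_j]=\delta_{ij}\frac{K_i-K_i^{-1}}{q_i^2-q_i^{-2}}$ with $q_i=q^{(\alpha_i,\alpha_i)/2}$, and the quantum Serre relations (with parameter $q_i^2$). It acts on tensor products through the coproduct $\Delta(E_i)=E_i\otimes 1+K_i\otimes E_i$, $\Delta(F_i)=F_i\otimes K_i^{-1}+1\otimes F_i$, $\Delta(K_i)=K_i\otimes K_i$. For a dominant weight $\lambda$, $L(\lambda)$ is the irreducible highest weight $U_q(g)$-module with highest weight $\lambda$ (the highest weight vector $v_\lambda$ satisfies $K_iv_\lambda=q^{2(\alpha_i,\lambda)}v_\lambda$),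 and $L^*(\mu)$ is the graded dual of $L(\mu)$, an irreducible lowest weight module with lowest weight $-\mu$. A module is absolutely indecomposable if it stays indecomposable after every extension of the base field. *)

(* Defs.v *)
From HB Require Import structures.
From mathcomp Require Import all_boot all_order all_algebra.
From mathcomp Require Import boolp functions.

Set Implicit Arguments.
Unset Strict Implicit.
Unset Printing Implicit Defensive.

Import Order.TTheory GRing.Theory Num.Theory.
Local Open Scope ring_scope.

Definition is_GCM n (A : 'M[int]_n) : Prop :=
  [/\ forall i, A i i = 2,
      forall i j, i != j -> A i j <= 0
    & forall i j, A i j = 0 -> A j i = 0].

Definition is_indecomposable_mx n (A : 'M[int]_n) : Prop :=
  (0 < n)%N /\
  forall S : {set 'I_n},
    (forall i j, i \in S -> j \notin S -> A i j = 0) -> S = set0 \/ S = setT.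

Definition mxQ n (A : 'M[int]_n) : 'M[rat]_n := map_mx intr A.

Definition cv_pos n (u : 'cV[rat]_n) : Prop := forall i, 0 < u i 0.
Definition cv_ge0 n (u : 'cV[rat]_n) : Prop := forall i, 0 <= u i 0.

(* Types of indecomposable matrices as in Kac's trichotomy.  Since A is
   integral, rational vectors may be used in place of real ones. *)
Definition affine_type n (A : 'M[int]_n) : Prop :=
  [/\ is_indecomposable_mx A,
      (\rank (mxQ A)).+1 = n,
      exists2 u, cv_pos u & mxQ A *m u = 0
    & forall v, cv_ge0 (mxQ A *m v) -> mxQ A *m v = 0].

Definition indefinite_type n (A : 'M[int]_n) : Prop :=
  [/\ is_indecomposable_mx A,
      exists2 u, cv_pos u & cv_pos (- (mxQ A *m u))
    & forall v, cv_ge0 (mxQ A *m v) -> cv_ge0 v -> v = 0].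

Definition gram_form r (G : 'M[int]_r) (x y : 'rV[int]_r) : int :=
  (x *m G *m y^T) 0 0.

(* The integral weight lattice P, identified with Z^wt_rank by the choice of a
   basis, with its even nondegenerate integral form and the simple roots.
   A matrix A that admits such data is symmetrizable: (alpha_i, alpha_j) =
   (alpha_i, alpha_i) / 2 * a_ij.  [realization_rank] says that P has the
   dimension 2n - rank A of the Cartan subalgebra in a realization of A; linear
   independence of the simple roots follows from [fundamental_weights]. *)
Record weight_data n (A : 'M[int]_n) := WeightData {
  wt_rank : nat;
  gram : 'M[int]_wt_rank;
  simple_root : 'I_n -> 'rV[int]_wt_rank;
  gram_sym : gram^T = gram;
  gram_nondeg : \det gram != 0;
  gram_even : forall x, (2 %| gram_form gram x x)%Z;
  root_length_gt0 : forall i,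
    0 < gram_form gram (simple_root i) (simple_root i);
  root_cartan : forall i j,
    2 * gram_form gram (simple_root i) (simple_root j) =
    A i j * gram_form gram (simple_root i) (simple_root i);
  wt_integral : forall i x,
    (gram_form gram (simple_root i) (simple_root i)
       %| 2 * gram_form gram (simple_root i) x)%Z;
  fundamental_weights : forall m : 'I_n -> int, exists x, forall i,
    2 * gram_form gram (simple_root i) x =
    m i * gram_form gram (simple_root i) (simple_root i);
  realization_rank : (wt_rank + \rank (mxQ A) = n + n)%N
}.

Notation weight D := 'rV[int]_(wt_rank D).

Definition wform n (A : 'M[int]_n) (D : weight_data A) : weight D -> weight D -> int :=
  gram_form (gram D).

Definition dominant n (A : 'M[int]_n) (D : weight_data A) (x : weight D) : Prop :=
  forall i, 0 <= wform (simple_root D i) x.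

Section QuantumNumbers.
Variables (L : fieldType) (p : L).

Definition qint (m : nat) : L := (p ^+ m - p ^- m) / (p - p^-1).
Definition qfact (m : nat) : L := \prod_(1 <= k < m.+1) qint k.
Definition qbinom (m k : nat) : L := qfact m / (qfact k * qfact (m - k)).

End QuantumNumbers.

Section UqModules.
Variables (L : fieldType) (q : L) (n : nat) (A : 'M[int]_n) (D : weight_data A).

Local Notation alpha := (simple_root D).
Local Notation "<< x , y >>" := (wform x y).

Definition qi (i : 'I_n) : L := q ^ (<<alpha i, alpha i>> %/ 2)%Z.

(* Used with [m] = 1 - a_ij. *)
Definition q_serre (V : lmodType L) (p : L) (m : nat) (X Y : V -> V) : Prop :=
  forall v : V,
    \sum_(k < m.+1)
      ((-1) ^+ k * qbinom p m k) *: iter (m - k) X (Y (iter k X v)) = 0.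

(* As U_q(g) is given by generators and relations, a module over it is a vector
   space with operators that satisfy these relations.  The base field L and
   q in L are parameters, so that scalars can be extended. *)
Record Uq_module := UqModule {
  Uq_carrier :> lmodType L;
  actE : 'I_n -> {linear Uq_carrier -> Uq_carrier};
  actF : 'I_n -> {linear Uq_carrier -> Uq_carrier};
  actK : 'I_n -> {linear Uq_carrier -> Uq_carrier};
  actKV : 'I_n -> {linear Uq_carrier -> Uq_carrier};
  act_KKV : forall i v, actK i (actKV i v) = v;
  act_KVK : forall i v, actKV i (actK i v) = v;
  act_KK : forall i j v, actK i (actK j v) = actK j (actK i v);
  act_KE : forall i j v, actK i (actE j (actKV i v)) =
    q ^ (2 * <<alpha i, alpha j>>) *: actE j v;
  act_KF : forall i j v, actK i (actF j (actKV i v)) =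
    q ^ (- (2 * <<alpha i, alpha j>>)) *: actF j v;
  act_EF : forall i j v, actE i (actF j v) - actF j (actE i v) =
    if i == j then (qi i ^+ 2 - qi i ^- 2)^-1 *: (actK i v - actKV i v) else 0;
  act_serreE : forall i j, i != j ->
    q_serre (qi i ^+ 2) `|1 - A i j|%N (actE i) (actE j);
  act_serreF : forall i j, i != j ->
    q_serre (qi i ^+ 2) `|1 - A i j|%N (actF i) (actF j)
}.

Record Uq_submodule (V : Uq_module) (S : V -> Prop) : Prop := {
  sub_0 : S 0;
  sub_lin : forall (a : L) u v, S u -> S v -> S (a *: u + v);
  sub_E : forall i v, S v -> S (actE V i v);
  sub_F : forall i v, S v -> S (actF V i v);
  sub_K : forall i v, S v -> S (actK V i v);
  sub_KV : forall i v, S v -> S (actKV V i v)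
}.

Definition irreducible (V : Uq_module) : Prop :=
  (exists v : V, v != 0) /\
  forall S : V -> Prop, Uq_submodule S ->
    (forall v, S v -> v = 0) \/ (forall v, S v).

Definition indecomposable (V : Uq_module) : Prop :=
  (exists v : V, v != 0) /\
  forall S1 S2 : V -> Prop, Uq_submodule S1 -> Uq_submodule S2 ->
    (forall v, S1 v -> S2 v -> v = 0) ->
    (forall v, exists v1 v2, [/\ S1 v1, S2 v2 & v = v1 + v2]) ->
    (forall v, S1 v -> v = 0) \/ (forall v, S2 v -> v = 0).

(* A module with a decomposition V = \bigoplus_x V_x over x in P.  The grading
   is part of the data because the K_i do not separate the weights when A is
   singular: for A affine the K_i act alike on V_x and V_(x + delta). *)
Record weight_module := WeightModule {
  wm_module :> Uq_module;
  wtspace : weight D -> wm_module -> Prop;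
  wtspace_0 : forall x, wtspace x 0;
  wtspace_lin : forall x (a : L) u v,
    wtspace x u -> wtspace x v -> wtspace x (a *: u + v);
  wtspace_span : forall v, exists (s : seq (weight D)) (f : weight D -> wm_module),
    (forall x, wtspace x (f x)) /\ v = \sum_(x <- s) f x;
  wtspace_direct : forall (s : seq (weight D)) (f : weight D -> wm_module),
    uniq s -> (forall x, wtspace x (f x)) -> \sum_(x <- s) f x = 0 ->
    forall x, x \in s -> f x = 0;
  wtspace_K : forall i x v, wtspace x v ->
    actK wm_module i v = q ^ (2 * <<alpha i, x>>) *: v;
  wtspace_E : forall i x v, wtspace x v ->
    wtspace (x + alpha i) (actE wm_module i v);
  wtspace_F : forall i x v, wtspace x v ->
    wtspace (x - alpha i) (actF wm_module i v)
}.

Record is_highest_weight_vector (x : weight D) (V : weight_module) (v : V) : Prop := {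
  hw_neq0 : v != 0;
  hw_weight : wtspace x v;
  hw_E : forall i, actE V i v = 0;
  hw_generates : forall S : V -> Prop, Uq_submodule S -> S v -> forall u, S u
}.

(* V is L(x), which is unique up to isomorphism. *)
Definition is_irreducible_highest_weight (x : weight D) (V : weight_module) : Prop :=
  (exists v : V, is_highest_weight_vector x v) /\ irreducible V.

Definition graded_functional (V : weight_module) (f : V -> L) : Prop :=
  exists s : seq (weight D), forall x, x \notin s ->
    forall v, wtspace x v -> f v = 0.

(* W is the graded dual of V, i.e. the direct sum of the duals of the weight
   spaces V_x, where [pair f] is the functional on V given by f in W.  The
   action on functionals is (a f)(v) = f(S(a) v), where S is the antipode of
   the coproduct used in [is_tensor_module]: S(E_i) = - K_i^-1 E_i,
   S(F_i) = - F_i K_i, S(K_i) = K_i^-1. *)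
Record is_graded_dual (V : weight_module) (W : Uq_module)
    (pair : {bilinear W -> V -> L^o}) : Prop := {
  gdual_inj : forall f, (forall v, pair f v = 0) -> f = 0;
  gdual_graded : forall f, graded_functional (pair f);
  gdual_surj : forall phi : {linear V -> L^o}, graded_functional phi ->
    exists f, forall v, pair f v = phi v;
  gdual_E : forall i f v,
    pair (actE W i f) v = - pair f (actKV V i (actE V i v));
  gdual_F : forall i f v,
    pair (actF W i f) v = - pair f (actF V i (actK V i v));
  gdual_K : forall i f v,
    pair (actK W i f) v = pair f (actKV V i v)
}.

(* T is V (x) W, up to unique isomorphism, with pure tensors [t v w] and the action
   through the coproduct Delta(E_i) = E_i (x) 1 + K_i (x) E_i,
   Delta(F_i) = F_i (x) K_i^-1 + 1 (x) F_i, Delta(K_i) = K_i (x) K_i. *)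
Record is_tensor_module (V W T : Uq_module) (t : {bilinear V -> W -> T}) : Prop := {
  tensor_universal : forall (Y : lmodType L) (b : {bilinear V -> W -> Y}),
    exists g : {linear T -> Y}, (forall v w, g (t v w) = b v w) /\
    forall g' : {linear T -> Y}, (forall v w, g' (t v w) = b v w) -> g' =1 g;
  tensor_E : forall i v w,
    actE T i (t v w) = t (actE V i v) w + t (actK V i v) (actE W i w);
  tensor_F : forall i v w,
    actF T i (t v w) = t (actF V i v) (actKV W i w) + t v (actF W i w);
  tensor_K : forall i v w,
    actK T i (t v w) = t (actK V i v) (actK W i w)
}.

Section Endomorphisms.
Variable V : Uq_module.

Definition Uq_endo : {pred V -> V} := fun f =>
  `[< linear f /\ forall i v,
      [/\ f (actE V i v) = actE V i (f v), f (actF V i v) = actF V i (f v),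
          f (actK V i v) = actK V i (f v) & f (actKV V i v) = actKV V i (f v)] >].

Lemma Uq_endoP f : reflect (linear f /\ forall i v,
      [/\ f (actE V i v) = actE V i (f v), f (actF V i v) = actF V i (f v),
          f (actK V i v) = actK V i (f v) & f (actKV V i v) = actKV V i (f v)])
  (f \in Uq_endo).
Proof. exact: asboolP. Qed.

Lemma Uq_endo_submod_closed : submod_closed Uq_endo.
Proof.
split=> [|a f g /Uq_endoP[lf cf] /Uq_endoP[lg cg]]; apply/Uq_endoP; split.
- by move=> b u v; change (0 = b *: 0 + 0 :> V); rewrite scaler0 addr0.
- move=> i v; change ([/\ 0 = actE V i 0, 0 = actF V i 0, 0 = actK V i 0
    & 0 = actKV V i 0]); by rewrite !linear0.
- move=> b u v; change (a *: f (b *: u + v) + g (b *: u + v) =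
    b *: (a *: f u + g u) + (a *: f v + g v)).
  by rewrite lf lg !scalerDr !scalerA addrACA (mulrC a).
- move=> i v; have [fE fF fK fKV] := cf i v; have [gE gF gK gKV] := cg i v.
  change ([/\ a *: f (actE V i v) + g (actE V i v) = actE V i (a *: f v + g v),
    a *: f (actF V i v) + g (actF V i v) = actF V i (a *: f v + g v),
    a *: f (actK V i v) + g (actK V i v) = actK V i (a *: f v + g v) &
    a *: f (actKV V i v) + g (actKV V i v) = actKV V i (a *: f v + g v)]).
  by rewrite fE fF fK fKV gE gF gK gKV !linearP.
Qed.

HB.instance Definition _ :=
  GRing.isSubmodClosed.Build L (V -> V) Uq_endo Uq_endo_submod_closed.

Record UqEnd := MkUqEnd { UqEnd_fun :> V -> V; _ : UqEnd_fun \in Uq_endo }.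

HB.instance Definition _ := [isSub for UqEnd_fun].
HB.instance Definition _ := [Choice of UqEnd by <:].
HB.instance Definition _ := [SubChoice_isSubLmodule of UqEnd by <:].

Lemma UqEnd_id_subproof : id \in Uq_endo. Proof. by apply/Uq_endoP. Qed.
Definition UqEnd_id := MkUqEnd UqEnd_id_subproof.

Lemma UqEnd_comp_subproof (f g : UqEnd) : f \o g \in Uq_endo.
Proof.
case: f g => [f Hf] [g Hg] /=; case/Uq_endoP: Hf => lf cf; case/Uq_endoP: Hg => lg cg.
apply/Uq_endoP; split=> [a u v|i v] /=; first by rewrite lg lf.
have [-> -> -> ->] := cg i v; by have [-> -> -> ->] := cf i (g v).
Qed.
Definition UqEnd_comp f g := MkUqEnd (UqEnd_comp_subproof f g).

Fact UqEnd_compA : associative UqEnd_comp.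
Proof. by move=> f g h; apply: val_inj. Qed.
Fact UqEnd_comp1f : left_id UqEnd_id UqEnd_comp.
Proof. by move=> f; apply: val_inj. Qed.
Fact UqEnd_compf1 : right_id UqEnd_id UqEnd_comp.
Proof. by move=> f; apply: val_inj. Qed.
Fact UqEnd_compDl : left_distributive UqEnd_comp +%R.
Proof. by move=> f g h; apply: val_inj. Qed.
Fact UqEnd_compDr : right_distributive UqEnd_comp +%R.
Proof.
move=> f g h; apply: val_inj; apply/funext => v /=.
have /Uq_endoP[lf _] := valP f.
by have := lf 1 (g v) (h v); rewrite !scale1r.
Qed.

HB.instance Definition _ := GRing.Zmodule_isPzRing.Build UqEnd
  UqEnd_compA UqEnd_comp1f UqEnd_compf1 UqEnd_compDl UqEnd_compDr.

End Endomorphisms.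

End UqModules.

(* X is L (x)_K V, up to unique isomorphism, with [iota] v = 1 (x) v. *)
Record is_scalar_extension (K L : fieldType) (phi : {rmorphism K -> L}) (q : K)
    n (A : 'M[int]_n) (D : weight_data A)
    (V : Uq_module q D) (X : Uq_module (phi q) D)
    (iota : {linear V -> X | phi \; *:%R}) : Prop := {
  ext_universal : forall (Y : lmodType L) (f : {linear V -> Y | phi \; *:%R}),
    exists g : {linear X -> Y}, (forall v, g (iota v) = f v) /\
    forall g' : {linear X -> Y}, (forall v, g' (iota v) = f v) -> g' =1 g;
  ext_E : forall i v, actE X i (iota v) = iota (actE V i v);
  ext_F : forall i v, actF X i (iota v) = iota (actF V i v);
  ext_K : forall i v, actK X i (iota v) = iota (actK V i v)
}.

Definition absolutely_indecomposable (K : fieldType) (q : K)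
    n (A : 'M[int]_n) (D : weight_data A) (V : Uq_module q D) : Prop :=
  forall (L : fieldType) (phi : {rmorphism K -> L}) (X : Uq_module (phi q) D)
         (iota : {linear V -> X | phi \; *:%R}),
    is_scalar_extension iota -> indecomposable X.

Definition Qq : fieldType := {fraction {poly rat}}.
Definition q_gen : Qq := FracField.tofrac 'X.

(* Main.v *)
From HB Require Import structures.
Require Import Defs.
From mathcomp Require Import all_boot all_order all_algebra.
From mathcomp Require Import boolp functions.
From mathcomp Require Import zify ring.

(* Let v be the highest weight vector of L(lambda) and f the lowest weight vector
   of L*(mu).  The vector v (x) f generates U(lambda, mu) and is killed by
   F_i^(lambda_i + 1) and E_i^(mu_i + 1), so an endomorphism is determined by its
   value w on v (x) f, which is killed by the same powers.  Elements of
   L(lambda) (x) L*(mu) are operators L(mu) -> L(lambda) through contraction.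
   Among the components of w of weight (lambda - beta, -mu + gamma) choose one
   with ht(beta) + ht(gamma) maximal: F_i^(lambda_i + 1) kills its first factor
   and E_i^(mu_i + 1) its second one.  By sl2-theory <beta, alpha_i^vee> and
   <gamma, alpha_i^vee> are nonnegative for all i; since A is affine or
   indefinite, they all vanish, and then sl2-theory shows that E_i kills the first
   factor and F_i the second.  By irreducibility beta = gamma = 0, hence w is a
   multiple of v (x) f.  After an extension L/K of scalars, a killed vector is
   expanded over elements of L that are linearly independent over K; its
   coefficients are killed, hence again multiples of v (x) f. *)

Set Implicit Arguments.
Unset Strict Implicit.
Unset Printing Implicit Defensive.

Import Order.TTheory GRing.Theory Num.Theory.
Local Open Scope ring_scope.

(** * Quantum integers and strings for quantum sl2 *)

(** The quantum integer $[a]$ for integers of either sign, as weights of vectors may be negative. *)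
Definition qnum (L : fieldType) (p : L) (a : int) : L :=
  (p ^ a - p ^ (- a)) / (p - p^-1).

Section QuantumSl2.
Variables (L : fieldType) (p : L).
Hypotheses (p_neq0 : p != 0) (p_gen : forall k, (0 < k)%N -> p ^+ k != 1).

Lemma subrV_neq0 : p - p^-1 != 0.
Proof.
rewrite subr_eq0; apply: contra (p_gen (isT : (0 < 2)%N)) => /eqP e.
by rewrite expr2 {2}e mulfV.
Qed.

Lemma exprz_neq1 (a : int) : a != 0 -> p ^ a != 1.
Proof.
case: a => k hk; first by apply: p_gen; case: k hk.
by rewrite NegzE -exprnN invr_eq1; apply: p_gen.
Qed.

Lemma qnum_neq0 (a : int) : a != 0 -> qnum p a != 0.
Proof.
move=> ha; rewrite mulf_neq0 ?invr_neq0 ?subrV_neq0 //.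
rewrite subr_eq0; apply/eqP => e.
have /exprz_neq1/eqP[] : a + a != 0 by lia.
by rewrite expfzDr // {2}e -expfzDr // subrr expr0z.
Qed.

Lemma qnum0 : qnum p 0 = 0.
Proof. by rewrite /qnum oppr0 subrr mul0r. Qed.

Lemma qnumN (a : int) : qnum p (- a) = - qnum p a.
Proof. by rewrite /qnum opprK -mulNr opprB. Qed.

(** For [b = m] this is the comparison of coefficients in the induction step of [iter_E_F]. *)
Lemma qnum_rec (a b : int) :
  qnum p (b + 1) * qnum p (a + b + 2) + qnum p a = qnum p (b + 2) * qnum p (a + b + 1).
Proof.
rewrite /qnum !opprD !expfzDr //.
rewrite -!invr_expz !expr1z.
have ha : p ^ a != 0 by rewrite expfz_neq0.
have hb : p ^ b != 0 by rewrite expfz_neq0.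
have := subrV_neq0; move: (p ^ a) (p ^ b) ha hb => x y hx hy hp.
have hp' : p * p - 1 != 0.
  apply: contraNneq hp => e.
  by rewrite -(mulfK p_neq0 (p - p^-1)) mulrBl mulVf // e mul0r.
by field; rewrite hx hy hp' p_neq0.
Qed.

(** [X a] stands for the vectors of weight [a]. It is left abstract because the results are applied
    to $E_i,F_i$, to $F_i,E_i$ with negated weights, and to precomposition on a space of
    functions. *)
Variables (V : lmodType L) (E F : {linear V -> V}) (X : int -> V -> Prop).
Hypotheses (XE : forall a v, X a v -> X (a + 2) (E v))
           (XF : forall a v, X a v -> X (a - 2) (F v))
           (XEF : forall a v, X a v -> E (F v) = F (E v) + qnum p a *: v).

Lemma iter_E_F m a v : X a v ->
  iter m.+1 E (F v) =
  F (iter m.+1 E v) + (qnum p m.+1%:Z * qnum p (a + m%:Z)) *: iter m E v.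
Proof.
elim: m a v => [|m IH] a v hv.
  by rewrite /= addr0 (XEF hv) /qnum mulfV ?subrV_neq0 // mul1r.
rewrite iterSr (XEF hv) -[in LHS](addr0 (F _)).
have lin : forall k u w b, iter k E (u + b *: w) = iter k E u + b *: iter k E w.
  by elim=> //= k IHk u w b; rewrite IHk linearD linearZ.
rewrite addr0 lin (IH _ _ (XE hv)) -!iterSr -addrA -scalerDl; congr (_ + _ *: _).
have -> : a + 2 + m%:Z = a + m%:Z + 2 by ring.
have -> : m.+1%:Z = m%:Z + 1 by lia.
have -> : m.+2%:Z = m%:Z + 2 by lia.
by rewrite qnum_rec -addrA.
Qed.

(** By induction on [M]: [F v] has weight [a - 2] and is killed by $E^{k+2}$, and $E^{k+1}$ sends it
    to $[k+1][a+k]E^kv$ by [iter_E_F]. This factor is nonzero because $a+k>0$ as long as [M] is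
    positive. *)
Lemma iter_E_iter_F M k a v : X a v -> iter k.+1 E v = 0 -> (M%:Z <= a + k%:Z)%R ->
  exists2 c, c != 0 & iter (k + M) E (iter M F v) = c *: iter k E v.
Proof.
elim: M k a v => [|M IH] k a v hv hk hM.
  by exists 1; rewrite ?oner_neq0 // scale1r addn0.
have hk2 : iter k.+2 E (F v) = 0.
  have e : iter k.+2 E v = 0 by rewrite iterS hk linear0.
  by rewrite (iter_E_F _ hv) e hk linear0 scaler0 addr0.
have [|c c0 e] := IH k.+1 (a - 2) (F v) (XF hv) hk2; first lia.
exists (c * (qnum p k.+1%:Z * qnum p (a + k%:Z))).
  by rewrite mulf_neq0 // mulf_neq0 // qnum_neq0 //; lia.
by rewrite addnS -addSn iterSr e (iter_E_F _ hv) hk linear0 add0r scalerA.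
Qed.

(** Let [k] be maximal with $E^kv\ne0$. If $M\le a+k$, then [iter_E_iter_F] would give
    $E^{k+M}F^Mv\ne0$; hence $a+k<M$. So $a<M$, and $a+1=M$ leaves only $k=0$. *)
Lemma sl2_string M a v : X a v -> (exists k, iter k E v = 0) -> iter M F v = 0 ->
  v != 0 -> (a < M%:Z)%R /\ (a + 1 = M%:Z -> E v = 0).
Proof.
move=> hv hk hM v0; have [k hk1 hk0] : exists2 k, iter k.+1 E v = 0 & iter k E v != 0.
  case: (ex_minnP (P := fun k => iter k E v == 0)) => [|[|k] /eqP e min].
  - by have [k e] := hk; exists k; apply/eqP.
  - by case/eqP: v0.
  by exists k => //; apply/negP => /min; rewrite ltnn.
have it0 : forall m, iter m E 0 = 0 by elim=> //= m ->; rewrite linear0.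
have key : (M%:Z <= a + k%:Z)%R -> False.
  move=> /(iter_E_iter_F hv hk1)[c c0]; rewrite hM it0 => /esym/eqP.
  by rewrite scaler_eq0 (negPf c0) (negPf hk0).
split; first by rewrite ltNge; apply/negP => h; apply: key; lia.
by move=> e; case: k hk1 hk0 key => // k _ _ []; lia.
Qed.

End QuantumSl2.

(** * Weights and coroots *)

Section Weights.
Variables (n : nat) (A : 'M[int]_n) (D : weight_data A).
Implicit Types x y z : weight D.
Local Notation alpha := (simple_root D).

Lemma wformDl x y z : wform (x + y) z = wform x z + wform y z.
Proof. by rewrite /wform /gram_form !mulmxDl mxE. Qed.

Lemma wformC x y : wform x y = wform y x.
Proof.
rewrite /wform /gram_form -[in LHS](trmxK (_ *m _ *m _)) mxE.
by rewrite !trmx_mul trmxK gram_sym mulmxA.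
Qed.

Lemma wformDr x y z : wform z (x + y) = wform z x + wform z y.
Proof. by rewrite wformC wformDl !(wformC _ z). Qed.

Lemma wform0r x : wform x 0 = 0.
Proof. by apply: (addrI (wform x 0)); rewrite -wformDr !addr0. Qed.

Lemma wformNr x y : wform x (- y) = - wform x y.
Proof. by apply: (addrI (wform x y)); rewrite -wformDr !subrr wform0r. Qed.

Lemma wformNl x y : wform (- y) x = - wform y x.
Proof. by rewrite wformC wformNr wformC. Qed.

Lemma wformMnr x y k : wform x (y *+ k) = wform x y *+ k.
Proof. by elim: k => [|k IH]; rewrite ?mulr0n ?wform0r // !mulrS wformDr IH. Qed.

Lemma wformMnl x y k : wform (y *+ k) x = wform y x *+ k.
Proof. by rewrite wformC wformMnr wformC. Qed.

Definition root_sum (c : 'I_n -> nat) : weight D := \sum_j alpha j *+ c j.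

Lemma root_sumS c i : root_sum (fun j => (c j + (j == i))%N) = root_sum c + alpha i.
Proof.
rewrite /root_sum; under eq_bigr do rewrite mulrnDr.
rewrite big_split /=; congr (_ + _).
by rewrite (bigD1 i) //= eqxx big1 ?addr0 // => j /negPf ->.
Qed.

Lemma wform_root_sum x c : wform x (root_sum c) = \sum_j wform x (alpha j) *+ c j.
Proof.
apply: (big_ind2 (fun y a => wform x y = a)) => [|y a z b <- <-|j _].
- exact: wform0r.
- by rewrite wformDr.
- exact: wformMnr.
Qed.

(** The value $\langle x,\alpha_i^\vee\rangle$; the integer division is exact by [wt_integral]. *)
Definition coroot (i : 'I_n) x : int :=
  ((2 * wform (alpha i) x)%R %/ wform (alpha i) (alpha i))%Z.

Lemma corootP i x : 2 * wform (alpha i) x = coroot i x * wform (alpha i) (alpha i).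
Proof. by rewrite /coroot divzK //; apply: wt_integral. Qed.

Lemma corootI i x (m : int) :
  2 * wform (alpha i) x = m * wform (alpha i) (alpha i) -> coroot i x = m.
Proof.
by rewrite corootP; apply/mulIf; rewrite gt_eqF //; exact: root_length_gt0.
Qed.

Lemma corootD i x y : coroot i (x + y) = coroot i x + coroot i y.
Proof. by apply: corootI; rewrite wformDr mulrDr [RHS]mulrDl -!corootP. Qed.

Lemma corootN i x : coroot i (- x) = - coroot i x.
Proof. by apply: corootI; rewrite wformNr mulrN mulNr -corootP. Qed.

Lemma coroot_root_sum i c : coroot i (root_sum c) = \sum_j A i j *+ c j.
Proof.
apply: corootI; rewrite wform_root_sum mulr_sumr mulr_suml; apply: eq_bigr => j _.
by rewrite mulrnAr [RHS]mulrnAl (root_cartan D).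
Qed.

Lemma dominant_coroot i x : dominant x -> 0 <= coroot i x.
Proof.
move=> /(_ i) h; have := corootP i x; have := root_length_gt0 D i.
by rewrite -/(wform _ _) => h0 e; nia.
Qed.

(** A weight with value 1 on all simple coroots, that is, a Weyl vector, will do. The pairing with
    [rho] is used as a height function in all that follows. *)
Lemma exists_height : exists rho : weight D, forall i, 0 < wform (alpha i) rho.
Proof.
have [x hx] := fundamental_weights D (fun _ => 1); exists x => i.
have := hx i; have := root_length_gt0 D i; rewrite -!/(wform _ _); nia.
Qed.

(** Linear independence of the simple roots, seen by pairing with a fundamental weight for [j]. *)
Lemma root_sum_multiple i c N : root_sum c = alpha i *+ N -> forall j, j != i -> c j = 0%N.
Proof.
move=> e j ji; have [x hx] := fundamental_weights D (fun k => (k == j)%:Z).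
have {}hx k : 2 * wform x (alpha k) = (k == j)%:Z * wform (alpha k) (alpha k).
  by rewrite wformC hx.
have := congr1 (fun y => 2 * wform x y) e.
rewrite wform_root_sum wformMnr (bigD1 j) //= big1 => [|k kj]; last first.
  have := hx k; rewrite (negPf kj) mul0r => /eqP; rewrite mulf_eq0 /= => /eqP ->.
  by rewrite mul0rn.
rewrite addr0 !(mulrnAr 2) !hx eqxx [i == j]eq_sym (negPf ji) mul0r mul0rn mul1r.
have := root_length_gt0 D j; rewrite -/(wform _ _) => h /eqP.
by rewrite mulrn_eq0 (gt_eqF h) orbF => /eqP.
Qed.

End Weights.

(** * Cartan matrices of affine or indefinite type *)

Section CartanType.
Variables (n : nat) (A : 'M[int]_n).

(** In affine type this is one of the defining properties; in indefinite type [c] itself must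
    vanish. This is where finite type is excluded. *)
Lemma cartan_sum_eq0 (c : 'I_n -> nat) : affine_type A \/ indefinite_type A ->
  (forall i, 0 <= \sum_j A i j *+ c j) -> forall i, \sum_j A i j *+ c j = 0.
Proof.
move=> tA hc.
pose u : 'cV[rat]_n := \col_j (c j)%:R.
have uE i : (mxQ A *m u) i 0 = (\sum_j A i j *+ c j)%:~R.
  rewrite mxE rmorph_sum; apply: eq_bigr => j _.
  by rewrite !mxE rmorphMn /= mulr_natr.
suff h : mxQ A *m u = 0.
  by move=> i; have := uE i; rewrite h mxE => /esym/eqP; rewrite intr_eq0 => /eqP.
have hA : cv_ge0 (mxQ A *m u) by move=> i; rewrite uE ler0z.
case: tA => [[_ _ _ h]|[_ _ h]]; first exact: h.
by rewrite (h u) ?mulmx0 // => i; rewrite mxE ler0n.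
Qed.

End CartanType.

(** * Modules over the quantized enveloping algebra *)

Section OpSpan.
Variables (L : fieldType) (V : lmodType L) (I : eqType).

(** In the applications the [X i] are the $F_i$ or the $E_i$, so that this is $U^-z$ or $U^+z$. *)
Inductive opspan (X : I -> V -> V) (z : V) : V -> Prop :=
| opspan_gen : opspan X z z
| opspan_0 : opspan X z 0
| opspan_lin a u v : opspan X z u -> opspan X z v -> opspan X z (a *: u + v)
| opspan_op i v : opspan X z v -> opspan X z (X i v).

Lemma opspanZ X z a v : opspan X z v -> opspan X z (a *: v).
Proof. by move=> h; rewrite -[_ *: _]addr0; apply: opspan_lin => //; apply: opspan_0. Qed.

Variables X Y K KV : I -> {linear V -> V}.
Hypotheses (KX : forall i j, exists c, forall v, K i (X j v) = c *: X j (K i v))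
           (KVX : forall i j, exists c, forall v, KV i (X j v) = c *: X j (KV i v))
           (YX : forall i j, exists c, forall v,
              Y i (X j v) = X j (Y i v) + c *: (K i v - KV i v)).

Variable z : V.
Hypotheses (Kz : forall i, exists c, K i z = c *: z)
           (KVz : forall i, exists c, KV i z = c *: z)
           (Yz : forall i, Y i z = 0).

Let S := opspan (fun i => X i : V -> V) z.

Lemma opspan_K i v : S v -> S (K i v).
Proof.
elim=> [||a u w _ IHu _ IHw|j u _ IH].
- by have [c ->] := Kz i; apply: opspanZ; apply: opspan_gen.
- by rewrite linear0; apply: opspan_0.
- by rewrite linearP; apply: opspan_lin.
- by have [c ->] := KX i j; apply: opspanZ; apply: opspan_op.
Qed.

Lemma opspan_KV i v : S v -> S (KV i v).
Proof.
elim=> [||a u w _ IHu _ IHw|j u _ IH].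
- by have [c ->] := KVz i; apply: opspanZ; apply: opspan_gen.
- by rewrite linear0; apply: opspan_0.
- by rewrite linearP; apply: opspan_lin.
- by have [c ->] := KVX i j; apply: opspanZ; apply: opspan_op.
Qed.

(** Moving [Y i] past an [X j] leaves a term in [K i] and [KV i], which preserve the span; in the
    end [Y i] reaches [z], which it kills. *)
Lemma opspan_Y i v : S v -> S (Y i v).
Proof.
elim=> [||a u w _ IHu _ IHw|j u hu IH].
- by rewrite Yz; apply: opspan_0.
- by rewrite linear0; apply: opspan_0.
- by rewrite linearP; apply: opspan_lin.
have [c ->] := YX i j; rewrite addrC; apply: opspan_lin; last exact: opspan_op.
by rewrite addrC -scaleN1r; apply: opspan_lin; [apply: opspan_KV|apply: opspan_K].
Qed.

End OpSpan.

Section Uq.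
Variables (L : fieldType) (q : L) (n : nat) (A : 'M[int]_n) (D : weight_data A).
Hypotheses (q_neq0 : q != 0) (q_nonroot : forall k, (0 < k)%N -> q ^+ k != 1).
Local Notation alpha := (simple_root D).

Section Module.
Variable V : Uq_module q D.

Lemma actK_E i j (v : V) :
  actK V i (actE V j v) = q ^ (2 * wform (alpha i) (alpha j)) *: actE V j (actK V i v).
Proof. by rewrite -act_KE act_KVK. Qed.

Lemma actK_F i j (v : V) :
  actK V i (actF V j v) = q ^ (- (2 * wform (alpha i) (alpha j))) *: actF V j (actK V i v).
Proof. by rewrite -act_KF act_KVK. Qed.

Lemma actKV_E i j (v : V) :
  actKV V i (actE V j v) = (q ^ (2 * wform (alpha i) (alpha j)))^-1 *: actE V j (actKV V i v).
Proof.
rewrite -{1}(act_KKV i v).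
have -> : actE V j (actK V i (actKV V i v)) =
    (q ^ (2 * wform (alpha i) (alpha j)))^-1 *: actK V i (actE V j (actKV V i v)).
  by rewrite actK_E scalerA mulVf ?scale1r // expfz_neq0.
by rewrite linearZ /= act_KVK.
Qed.

Lemma actKV_F i j (v : V) :
  actKV V i (actF V j v) =
  (q ^ (- (2 * wform (alpha i) (alpha j))))^-1 *: actF V j (actKV V i v).
Proof.
rewrite -{1}(act_KKV i v).
have -> : actF V j (actK V i (actKV V i v)) =
    (q ^ (- (2 * wform (alpha i) (alpha j))))^-1 *: actK V i (actF V j (actKV V i v)).
  by rewrite actK_F scalerA mulVf ?scale1r // expfz_neq0.
by rewrite linearZ /= act_KVK.
Qed.

Lemma actE_F_comm i j : exists c, forall v : V,
  actE V i (actF V j v) = actF V j (actE V i v) + c *: (actK V i v - actKV V i v).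
Proof.
exists (if i == j then (qi q D i ^+ 2 - qi q D i ^- 2)^-1 else 0) => v.
have /eqP := act_EF i j v; rewrite subr_eq addrC => /eqP ->.
by case: ifP; rewrite ?scale0r.
Qed.

Lemma actF_E_comm i j : exists c, forall v : V,
  actF V i (actE V j v) = actE V j (actF V i v) + c *: (actK V i v - actKV V i v).
Proof.
exists (if j == i then - (qi q D j ^+ 2 - qi q D j ^- 2)^-1 else 0) => v.
have /eqP := act_EF j i v; rewrite subr_eq addrC => /eqP ->.
case: ifP => [/eqP ->|_]; last by rewrite scale0r !addr0.
by rewrite -addrA -scalerDl subrr scale0r addr0.
Qed.

Lemma opspan_F_submodule (z : V) :
  (forall i, exists c, actK V i z = c *: z) -> (forall i, exists c, actKV V i z = c *: z) ->
  (forall i, actE V i z = 0) -> Uq_submodule (opspan (fun i => actF V i : V -> V) z).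
Proof.
move=> Kz KVz Ez.
have KF i j : exists c, forall v, actK V i (actF V j v) = c *: actF V j (actK V i v).
  by eexists => v; apply: actK_F.
have KVF i j : exists c, forall v, actKV V i (actF V j v) = c *: actF V j (actKV V i v).
  by eexists => v; apply: actKV_F.
split; [exact: opspan_0|exact: opspan_lin| |exact: opspan_op| |].
- exact: (opspan_Y KF KVF actE_F_comm Kz KVz Ez).
- exact: (opspan_K KF Kz).
- exact: (opspan_KV KVF KVz).
Qed.

Lemma opspan_E_submodule (z : V) :
  (forall i, exists c, actK V i z = c *: z) -> (forall i, exists c, actKV V i z = c *: z) ->
  (forall i, actF V i z = 0) -> Uq_submodule (opspan (fun i => actE V i : V -> V) z).
Proof.
move=> Kz KVz Fz.
have KE i j : exists c, forall v, actK V i (actE V j v) = c *: actE V j (actK V i v).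
  by eexists => v; apply: actK_E.
have KVE i j : exists c, forall v, actKV V i (actE V j v) = c *: actE V j (actKV V i v).
  by eexists => v; apply: actKV_E.
split; [exact: opspan_0|exact: opspan_lin|exact: opspan_op| | |].
- exact: (opspan_Y KE KVE actF_E_comm Kz KVz Fz).
- exact: (opspan_K KE Kz).
- exact: (opspan_KV KVE KVz).
Qed.

End Module.

(** This is $q_i^2$, the parameter of the quantum $sl_2$ belonging to [i]; on weight $x$ the
    operator $K_i$ acts by its power with exponent $\langle x,\alpha_i^\vee\rangle$. *)
Definition qd (i : 'I_n) : L := q ^ (wform (alpha i) (alpha i)).

Lemma qdE i : qi q D i ^+ 2 = qd i.
Proof.
rewrite /qi /qd exprnP exprz_exp; congr (_ ^ _).
by rewrite divzK //; apply: gram_even.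
Qed.

Lemma qd_neq0 i : qd i != 0. Proof. exact: expfz_neq0. Qed.

Lemma qd_gen i k : (0 < k)%N -> qd i ^+ k != 1.
Proof.
move=> k0; rewrite exprnP exprz_exp exprz_neq1 //.
have := root_length_gt0 D i; rewrite -/(wform _ _); nia.
Qed.

Lemma qd_coroot i x : q ^ (2 * wform (alpha i) x) = qd i ^ coroot i x.
Proof. by rewrite exprz_exp corootP mulrC. Qed.

Lemma act_EF_qnum (V : Uq_module q D) i (a : int) (v : V) :
  actK V i v = qd i ^ a *: v ->
  actE V i (actF V i v) = actF V i (actE V i v) + qnum (qd i) a *: v.
Proof.
move=> hK; have hKV : actKV V i v = qd i ^ (- a) *: v.
  rewrite -[in RHS](act_KVK i v) hK linearZ scalerA -expfzDr ?qd_neq0 //.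
  by rewrite addNr expr0z scale1r.
have /eqP := act_EF i i v; rewrite eqxx subr_eq addrC => /eqP ->.
by rewrite hK hKV -scalerBl scalerA qdE mulrC /qnum.
Qed.

End Uq.

(** * Projections onto weight spaces *)

Section Projections.
Variables (L : fieldType) (q : L) (n : nat) (A : 'M[int]_n) (D : weight_data A).
Hypotheses (q_neq0 : q != 0) (q_nonroot : forall k, (0 < k)%N -> q ^+ k != 1).
Variable V : weight_module q D.
Implicit Types (x y : weight D) (v : V).
Local Notation alpha := (simple_root D).

Lemma big_supp_sub (s1 s2 : seq (weight D)) (f : weight D -> V) :
  uniq s1 -> uniq s2 -> {subset s1 <= s2} -> (forall x, x \notin s1 -> f x = 0) ->
  \sum_(x <- s2) f x = \sum_(x <- s1) f x.
Proof.
move=> u1 u2 sub f0; rewrite (bigID (mem s1)) /= [X in _ + X]big1 ?addr0; last first.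
  by move=> x /f0.
rewrite -big_filter; apply: perm_big; apply: uniq_perm; rewrite ?filter_uniq //.
by move=> x; rewrite mem_filter andb_idr //; apply: sub.
Qed.

Definition wt_decomp v (f : weight D -> V) : Prop :=
  (forall x, wtspace x (f x)) /\
  exists s, [/\ uniq s, forall x, x \notin s -> f x = 0 & v = \sum_(x <- s) f x].

Lemma wtspaceZ x a v : wtspace x v -> wtspace x (a *: v).
Proof. by move=> h; rewrite -[_ *: _]addr0; apply: wtspace_lin => //; apply: wtspace_0. Qed.

Lemma wt_decomp_exists v : exists f, wt_decomp v f.
Proof.
have [s [f [hf ->]]] := wtspace_span v.
(* The list may contain a weight several times; its component is then counted with multiplicity. *)
exists (fun x => if x \in s then (count_mem x s)%:R *: f x else 0).
split=> [x|]; first by case: ifP => _; [apply: wtspaceZ|apply: wtspace_0].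
exists (undup s); split; first exact: undup_uniq.
  by move=> x; rewrite mem_undup => /negPf ->.
rewrite -big_undup_iterop_count /= big_seq [RHS]big_seq; apply: eq_bigr => x.
rewrite mem_undup => ->; rewrite scaler_nat Monoid.iteropE.
by elim: (count_mem x s) => [|m] //= ->; rewrite mulrS.
Qed.

Lemma wt_decomp_unique v f g : wt_decomp v f -> wt_decomp v g -> f =1 g.
Proof.
move=> [hf [s1 [u1 f0 ->]]] [hg [s2 [u2 g0 e]]] x.
have us := undup_uniq (s1 ++ s2); set s := undup _ in us.
have sub1 : {subset s1 <= s} by move=> y h; rewrite mem_undup mem_cat h.
have sub2 : {subset s2 <= s} by move=> y h; rewrite mem_undup mem_cat h orbT.
have [hx|hx] := boolP (x \in s); last first.
  by rewrite f0 ?g0 //; apply: contra hx; [apply: sub2|apply: sub1].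
apply/eqP; rewrite -subr_eq0; apply/eqP.
apply: (wtspace_direct (f := fun y => f y - g y) us) => // [y|].
  by rewrite addrC -scaleN1r; apply: wtspace_lin.
by rewrite sumrB (big_supp_sub u1 us sub1 f0) (big_supp_sub u2 us sub2 g0) e subrr.
Qed.

(** The grading consists of predicates only, so the components are chosen by [cid];
    [wt_decomp_unique] shows that they are well defined and linear in [v]. *)
Definition wproj x v : V := sval (cid (wt_decomp_exists v)) x.

Lemma wprojP v : wt_decomp v (wproj^~ v).
Proof. exact: (svalP (cid (wt_decomp_exists v))). Qed.

Lemma wproj_eq v f : wt_decomp v f -> forall x, wproj x v = f x.
Proof. by move=> h x; apply: wt_decomp_unique (wprojP v) h x. Qed.

Lemma wproj_is_linear x : linear (wproj x).
Proof.
move=> a u v.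
apply: (wproj_eq (v := a *: u + v) (f := fun x => a *: wproj x u + wproj x v)).
have [hu [s1 [u1 f0 eu]]] := wprojP u; have [hv [s2 [u2 g0 ev]]] := wprojP v.
split=> [y|]; first exact: wtspace_lin.
have us := undup_uniq (s1 ++ s2); set s := undup _ in us.
have sub1 : {subset s1 <= s} by move=> y h; rewrite mem_undup mem_cat h.
have sub2 : {subset s2 <= s} by move=> y h; rewrite mem_undup mem_cat h orbT.
exists s; split=> // [y|].
  rewrite mem_undup mem_cat negb_or => /andP[h1 h2].
  by rewrite f0 // g0 // scaler0 addr0.
rewrite big_split -scaler_sumr /= (big_supp_sub u1 us sub1 f0).
by rewrite (big_supp_sub u2 us sub2 g0) -eu -ev.
Qed.

HB.instance Definition _ x :=
  GRing.isLinear.Build L V V *:%R (wproj x) (wproj_is_linear x).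

Lemma wproj_wt x v : wtspace x (wproj x v).
Proof. by case: (wprojP v). Qed.

Lemma wproj_supp v : exists s, [/\ uniq s, forall x, x \notin s -> wproj x v = 0
  & v = \sum_(x <- s) wproj x v].
Proof. by case: (wprojP v). Qed.

Lemma wproj_wtspace x y v : wtspace y v -> wproj x v = if x == y then v else 0.
Proof.
move=> hv; apply: (wproj_eq (f := fun x => if x == y then v else 0)); split=> [z|].
  by case: eqP => [->//|_]; apply: wtspace_0.
exists [:: y]; split=> // [z|]; last by rewrite big_seq1 eqxx.
by rewrite inE => /negPf ->.
Qed.

Lemma wproj_id x v : wtspace x v -> wproj x v = v.
Proof. by move=> /(wproj_wtspace x) ->; rewrite eqxx. Qed.

Lemma wproj_neq0 v : v != 0 -> exists x, wproj x v != 0.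
Proof.
move=> v0; have [s [_ _ e]] := wproj_supp v; apply: contrapT => h.
case/eqP: v0; rewrite e big1 // => x _; apply/eqP/negPn/negP => hx; by apply: h; exists x.
Qed.

(** [T] carries the decomposition of [v] to one of [T v], with the weights relabelled by [sigma]. *)
Lemma wproj_shift (T : {linear V -> V}) (sigma tau : weight D -> weight D) :
  cancel sigma tau -> cancel tau sigma ->
  (forall x v, wtspace x v -> wtspace (sigma x) (T v)) ->
  forall x v, wproj x (T v) = T (wproj (tau x) v).
Proof.
move=> st ts hT x v; apply: (wproj_eq (f := fun x => T (wproj (tau x) v))).
have [s [us s0 e]] := wproj_supp v; split=> [y|].
  by rewrite -{1}(ts y); apply/hT/wproj_wt.
exists (map sigma s); split.
- by rewrite map_inj_uniq //; apply: can_inj st.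
- move=> y hy; rewrite s0 ?linear0 //; apply: contra hy => hy.
  by rewrite -(ts y) map_f.
by rewrite big_map {1}e linear_sum; apply: eq_bigr => y _; rewrite st.
Qed.

Lemma wproj_E x i v : wproj x (actE V i v) = actE V i (wproj (x - alpha i) v).
Proof.
apply: (wproj_shift (sigma := fun x => x + alpha i) (tau := fun x => x - alpha i)) =>
  [y|y|y w]; rewrite ?addrK ?subrK //.
exact: wtspace_E.
Qed.

Lemma wproj_F x i v : wproj x (actF V i v) = actF V i (wproj (x + alpha i) v).
Proof.
apply: (wproj_shift (sigma := fun x => x - alpha i) (tau := fun x => x + alpha i)) =>
  [y|y|y w]; rewrite ?addrK ?subrK //.
exact: wtspace_F.
Qed.

Lemma wtspace_KV x i v : wtspace x v ->
  actKV V i v = (q ^ (2 * wform (alpha i) x))^-1 *: v.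
Proof.
move=> h; rewrite -[in RHS](act_KVK i v) (wtspace_K _ h) linearZ scalerA /=.
by rewrite mulVf ?scale1r // expfz_neq0.
Qed.

Lemma wproj_K x i v : wproj x (actK V i v) = actK V i (wproj x v).
Proof.
apply: (wproj_shift (sigma := id) (tau := id)) => // y w h.
by rewrite (wtspace_K _ h); apply: wtspaceZ.
Qed.

Lemma wproj_KV x i v : wproj x (actKV V i v) = actKV V i (wproj x v).
Proof.
apply: (wproj_shift (sigma := id) (tau := id)) => // y w h.
by rewrite (wtspace_KV _ h); apply: wtspaceZ.
Qed.

Lemma iter_wt_E i k x v : wtspace x v -> wtspace (x + alpha i *+ k) (iter k (actE V i) v).
Proof.
by move=> h; elim: k => [|k IH]; rewrite ?addr0 // mulrSr addrA; apply: wtspace_E.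
Qed.

Lemma iter_wt_F i k x v : wtspace x v -> wtspace (x - alpha i *+ k) (iter k (actF V i) v).
Proof.
by move=> h; elim: k => [|k IH]; rewrite ?subr0 // mulrSr opprD addrA; apply: wtspace_F.
Qed.

End Projections.

(** * Highest weight modules *)

Section KWeights.
Variables (L : fieldType) (q : L) (n : nat) (A : 'M[int]_n) (D : weight_data A).
Hypotheses (q_neq0 : q != 0) (q_nonroot : forall k, (0 < k)%N -> q ^+ k != 1).
Variables (V : Uq_module q D) (i : 'I_n).

Definition kweight (a : int) (v : V) : Prop := actK V i v = qd q D i ^ a *: v.

Lemma qd_double : q ^ (2 * wform (simple_root D i) (simple_root D i)) = qd q D i ^ 2.
Proof. by rewrite exprz_exp mulrC. Qed.

Lemma kweight_E a v : kweight a v -> kweight (a + 2) (actE V i v).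
Proof.
rewrite /kweight => e.
by rewrite actK_E // e linearZ /= scalerA qd_double -expfzDr ?qd_neq0 // addrC.
Qed.

Lemma kweight_F a v : kweight a v -> kweight (a - 2) (actF V i v).
Proof.
rewrite /kweight => e.
rewrite actK_F // e linearZ /= scalerA -invr_expz qd_double invr_expz.
by rewrite -expfzDr ?qd_neq0 // addrC.
Qed.

Lemma kweight_EF a v : kweight a v ->
  actE V i (actF V i v) = actF V i (actE V i v) + qnum (qd q D i) a *: v.
Proof. exact: act_EF_qnum. Qed.

(** The $sl_2$ relation is kept when $E_i$ and $F_i$ are exchanged and weights are negated; powers
    of $F_i$ can thus be treated by [iter_E_F]. *)
Lemma kweight_FE a v : kweight (- a) v ->
  actF V i (actE V i v) = actE V i (actF V i v) + qnum (qd q D i) a *: v.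
Proof.
by move=> /kweight_EF ->; rewrite qnumN -addrA scaleNr addNr addr0.
Qed.

Lemma iter_linear0 (T : {linear V -> V}) k : iter k T 0 = 0.
Proof. by elim: k => //= k ->; rewrite linear0. Qed.

End KWeights.

Section HighestWeight.
Variables (L : fieldType) (q : L) (n : nat) (A : 'M[int]_n) (D : weight_data A).
Hypotheses (q_neq0 : q != 0) (q_nonroot : forall k, (0 < k)%N -> q ^+ k != 1).
Variables (V : weight_module q D) (lam : weight D) (v0 : V).
Hypothesis hw : is_highest_weight_vector lam v0.
Local Notation alpha := (simple_root D).
Variable rho : weight D.
Hypothesis rho_gt0 : forall i, 0 < wform (alpha i) rho.
Local Notation hgt x := (wform x rho).

Lemma wtspace_kweight i x (v : V) : wtspace x v -> kweight i (coroot i x) v.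
Proof. by move=> h; rewrite /kweight (wtspace_K _ h) qd_coroot. Qed.

(** Since the $E_i$ kill [v0], the subspace $U^-v_0$ is a submodule, hence all of [V]. *)
Lemma hw_ind (P : V -> Prop) : P v0 -> P 0 ->
  (forall a u v, P u -> P v -> P (a *: u + v)) -> (forall i v, P v -> P (actF V i v)) ->
  forall v, P v.
Proof.
move=> Pv P0 Pl PF v; have hv := hw_weight hw.
have hS : Uq_submodule (opspan (fun i => actF V i : V -> V) v0).
  apply: (opspan_F_submodule q_neq0) => i; last exact: (hw_E hw).
    by eexists; apply: wtspace_K hv.
  by eexists; apply: (wtspace_KV q_neq0 _ hv).
by elim: (hw_generates hw hS (opspan_gen _ _) v) => //; auto.
Qed.

Lemma hw_support x (v : V) : wproj x v != 0 -> exists c, x = lam - root_sum D c.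
Proof.
elim/hw_ind: v x => [x|x|a u v IHu IHv x|i v IH x].
- rewrite (wproj_wtspace _ (hw_weight hw)); case: (x =P lam) => [-> _|]; rewrite ?eqxx //.
  by exists (fun _ => 0%N); rewrite /root_sum big1 ?subr0.
- by rewrite linear0 eqxx.
- rewrite linearP /=; have [->|/IHu //] := eqVneq (wproj x u) 0.
  by rewrite scaler0 add0r => /IHv.
rewrite wproj_F // => h; have [|c e] := IH (x + alpha i).
  by apply: contraNneq h => ->; rewrite linear0.
exists (fun j => (c j + (j == i))%N).
by rewrite root_sumS opprD addrA -e addrK.
Qed.

Lemma hgt_root_sum c : hgt (root_sum D c) = \sum_j hgt (alpha j) *+ c j.
Proof. by rewrite wformC wform_root_sum; apply: eq_bigr => j _; rewrite wformC. Qed.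

Lemma hw_hgt x (v : V) : wtspace x v -> v != 0 ->
  hgt x <= hgt lam /\ (hgt x = hgt lam -> x = lam).
Proof.
move=> hv v0'; have [|c ->] := @hw_support x v; first by rewrite wproj_id.
rewrite wformDl wformNl hgt_root_sum.
have ge0 j : true -> 0 <= hgt (alpha j) *+ c j by move=> _; rewrite mulrn_wge0 // ltW.
have s0 := sumr_ge0 _ ge0; split; first by rewrite lerBlDr lerDl.
move=> /eqP; rewrite subr_eq addrC -subr_eq subrr eq_sym (psumr_eq0 _ ge0) => /allP h.
rewrite /root_sum big1 ?subr0 // => j _.
have /implyP/(_ isT) := h j (mem_index_enum j).
by rewrite mulrn_eq0 (gt_eqF (rho_gt0 j)) orbF => /eqP ->.
Qed.

Lemma hw_above x (v : V) : hgt lam < hgt x -> wproj x v = 0.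
Proof.
move=> h; apply/eqP/negPn/negP => /(hw_hgt (wproj_wt x v))[]; by rewrite leNgt h.
Qed.

(** A vector $F_iv$ has no component of weight [lam]: it would come from weight [lam + alpha i],
    which lies above [lam]. *)
Lemma hw_line (v : V) : exists c, wproj lam v = c *: v0.
Proof.
elim/hw_ind: v => [||a u v [c1 e1] [c2 e2]|i v _].
- by exists 1; rewrite (wproj_id (hw_weight hw)) scale1r.
- by exists 0; rewrite linear0 scale0r.
- by exists (a * c1 + c2); rewrite linearP /= e1 e2 scalerDl scalerA.
by exists 0; rewrite wproj_F // hw_above ?linear0 ?scale0r // wformDl ltrDl.
Qed.

(** By linear independence of the simple roots, only the product $F_i^k$ leads from $\lambda$ to
    $\lambda-k\alpha_i$. *)
Lemma hw_string i k (v : V) :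
  exists c, wproj (lam - alpha i *+ k) v = c *: iter k (actF V i) v0.
Proof.
elim/hw_ind: v k => [|k|a u v IHu IHv k|j v IH k].
- case=> [|k].
    by exists 1; rewrite subr0 (wproj_id (hw_weight hw)) scale1r.
  exists 0; rewrite scale0r (wproj_wtspace _ (hw_weight hw)) ifN //.
  apply/eqP => e; have /eqP : hgt (lam - alpha i *+ k.+1) = hgt lam by rewrite e.
  rewrite wformDl wformNl wformMnl -subr_eq0 addrAC subrr add0r oppr_eq0.
  by rewrite mulrn_eq0 (gt_eqF (rho_gt0 i)).
- by exists 0; rewrite linear0 scale0r.
- have [[c1 e1] [c2 e2]] := (IHu k, IHv k).
  by exists (a * c1 + c2); rewrite linearP /= e1 e2 scalerDl scalerA.
rewrite wproj_F //; have [->|ji] := eqVneq j i.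
  case: k => [|k]; first by exists 0; rewrite subr0 hw_above ?linear0 ?scale0r // wformDl ltrDl.
  by have [c e] := IH k; exists c; rewrite mulrSr opprD addrA subrK e linearZ.
(* For $j\ne i$ the source would have weight $\lambda-k\alpha_i+\alpha_j$, which is not of the form
   $\lambda-\sum_l c_l\alpha_l$ with natural numbers $c_l$. *)
exists 0; rewrite scale0r; apply/eqP/negPn/negP => h.
have [|c] := @hw_support (lam - alpha i *+ k + alpha j) v.
  by apply: contraNneq h => ->; rewrite linear0.
rewrite -addrA => /addrI e.
have /root_sum_multiple/(_ j ji)/eqP : root_sum D (fun l => (c l + (l == j))%N) = alpha i *+ k.
  by rewrite root_sumS -(opprK (root_sum D c)) -e opprD opprK subrK.
by rewrite eqxx addn1.
Qed.

End HighestWeight.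

(** * Irreducible highest weight modules *)

Section IrreducibleHighestWeight.
Variables (L : fieldType) (q : L) (n : nat) (A : 'M[int]_n) (D : weight_data A).
Hypotheses (q_neq0 : q != 0) (q_nonroot : forall k, (0 < k)%N -> q ^+ k != 1).
Variables (V : weight_module q D) (lam : weight D) (v0 : V).
Hypothesis hw : is_highest_weight_vector lam v0.
Local Notation alpha := (simple_root D).
Variable rho : weight D.
Hypothesis rho_gt0 : forall i, 0 < wform (alpha i) rho.
Local Notation hgt x := (wform x rho).

Lemma hw_E_nilpotent i x (v : V) : wtspace x v -> exists k, iter k (actE V i) v = 0.
Proof.
(* Each $E_i$ raises the integer [hgt] by at least 1, so this many steps lead above [lam]. *)
move=> hv; exists `|hgt lam - hgt x|.+1%N.
rewrite -(wproj_id (iter_wt_E i _ hv)); apply: (hw_above q_neq0 hw rho_gt0).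
by rewrite wformDl wformMnl; have := rho_gt0 i; nia.
Qed.

Lemma hw_descend x (v : V) : wtspace x v -> x != lam ->
  exists g : 'I_n -> V, (forall i, wtspace (x + alpha i) (g i)) /\ v = \sum_i actF V i (g i).
Proof.
move=> hv xlam; rewrite -(wproj_id hv) => {hv}.
elim/(hw_ind q_neq0 hw): v => [||a u v [g1 [h1 e1]] [g2 [h2 e2]]|j v _].
- exists (fun _ => 0); split=> [i|]; first exact: wtspace_0.
  rewrite (wproj_wtspace _ (hw_weight hw)) (negPf xlam).
  by rewrite big1 // => i _; rewrite linear0.
- exists (fun _ => 0); split=> [i|]; first exact: wtspace_0.
  by rewrite linear0 big1 // => i _; rewrite linear0.
- exists (fun i => a *: g1 i + g2 i); split=> [i|]; first exact: wtspace_lin.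
  rewrite linearP /= e1 e2 scaler_sumr -big_split; apply: eq_bigr => i _.
  by rewrite linearP.
exists (fun i => if i == j then wproj (x + alpha i) v else 0); split=> [i|].
  by case: ifP => _; [apply: wproj_wt|apply: wtspace_0].
rewrite (bigD1 j) //= eqxx big1 ?addr0 ?wproj_F // => i /negPf ->.
by rewrite linear0.
Qed.

(* A substitute for finite dimensionality of the weight spaces. *)
Lemma hw_finitely_determined x : exists s : seq V, forall h : {linear V -> L^o},
  (forall y, y \in s -> h y = 0) -> forall v, wtspace x v -> h v = 0.
Proof.
have [k] : exists k : nat, hgt lam < hgt x + k%:Z.
  by exists `|hgt lam - hgt x|.+1; lia.
elim: k x => [|k IH] x hk.
  exists [::] => h _ v hv; rewrite -(wproj_id hv) (hw_above q_neq0 hw rho_gt0) ?linear0 //.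
  by move: hk; rewrite addr0.
have [->|xlam] := eqVneq x lam.
  exists [:: v0] => h hs v hv; rewrite -(wproj_id hv).
  have [c ->] := hw_line q_neq0 hw rho_gt0 v.
  by rewrite linearZ /= hs ?inE // scaler0.
have sP i : {s : seq V | forall h : {linear V -> L^o},
    (forall y, y \in s -> h y = 0) -> forall v, wtspace (x + alpha i) v -> h v = 0}.
  by apply: cid; apply: IH; rewrite wformDl; have := rho_gt0 i; lia.
(* By [hw_descend], [h] vanishes on weight [x] as soon as every $h\circ F_i$ vanishes on weight
   [x + alpha i]; so the lists for these weights are moved down by $F_i$. *)
exists (flatten [seq [seq actF V i y | y <- sval (sP i)] | i <- enum 'I_n]) => h hs v hv.
have [g [hg ->]] := hw_descend hv xlam.
rewrite linear_sum big1 // => i _.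
apply: (svalP (sP i) (h \o actF V i : {linear V -> L^o})) (hg i) => y hy /=.
apply: hs; apply/flattenP; exists [seq actF V i y | y <- sval (sP i)].
  by apply: map_f; rewrite mem_enum.
exact: map_f.
Qed.

Hypothesis irr : irreducible V.

(** If $z\ne0$, then $U^-z$ is a nonzero submodule whose heights do not exceed that of [x], which is
    less than that of [lam]. It misses [v0], against irreducibility. *)
Lemma hw_singular x (z : V) : wtspace x z -> (forall i, actE V i z = 0) -> x != lam -> z = 0.
Proof.
move=> hz Ez xlam; apply/eqP/negPn/negP => z0.
have hx : hgt x < hgt lam.
  have [h1 h2] := hw_hgt q_neq0 hw rho_gt0 hz z0; rewrite lt_neqAle h1 andbT.
  by apply: contra xlam => /eqP/h2 ->.
have hS : Uq_submodule (opspan (fun i => actF V i : V -> V) z).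
  apply: (opspan_F_submodule q_neq0) => // i.
    by eexists; apply: wtspace_K hz.
  by eexists; apply: (wtspace_KV q_neq0 _ hz).
have [/(_ z (opspan_gen _ _))|all] := irr.2 _ hS; first exact/eqP.
have below u : opspan (fun i => actF V i : V -> V) z u ->
    forall y, hgt x < hgt y -> wproj y u = 0.
  elim=> [|y _|a u' v' _ IHu _ IHv y hy|i v' _ IH y hy].
  - move=> y hy; rewrite (wproj_wtspace _ hz) ifN //.
    by apply: contraTneq hy => ->; rewrite ltxx.
  - by rewrite linear0.
  - by rewrite linearP /= IHu // IHv // scaler0 addr0.
  rewrite wproj_F // IH ?linear0 // wformDl; apply: lt_trans hy _.
  by rewrite ltrDl.
have := hw_neq0 hw; rewrite -(wproj_id (hw_weight hw)).
by rewrite (below v0 (all v0)) ?eqxx.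
Qed.

(** The vector $F_i^{m+1}v_0$ is singular of a weight other than [lam]: for $j\ne i$ the operator
    $E_j$ commutes with $F_i$ and kills $v_0$, and for $E_i$ the coefficient in the $sl_2$ relation
    vanishes. *)
Lemma hw_integrable i m : coroot i lam = m%:Z -> iter m.+1 (actF V i) v0 = 0.
Proof.
move=> hm; have p0 := qd_neq0 D q_neq0 i; have pg := qd_gen D q_neq0 q_nonroot i.
apply: (hw_singular (iter_wt_F i m.+1 (hw_weight hw))); last first.
  apply/eqP => e; have := congr1 (fun y => hgt y) e.
  by rewrite wformDl wformNl wformMnl; have := rho_gt0 i; nia.
move=> j; have [->|ji] := eqVneq j i.
  (* With $E_i$ and $F_i$ exchanged, [v0] has weight $-m$, and [iter_E_F] produces the factor
     $[-m+m]=0$. *)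
  have kw : kweight i (- (- m%:Z)) v0.
    by rewrite opprK -hm; apply: wtspace_kweight (hw_weight hw).
  have XE a (v : V) : kweight i (- a) v -> kweight i (- (a + 2)) (actF V i v).
    by move=> h; rewrite opprD; apply: kweight_F.
  have := iter_E_F p0 pg XE (fun a v => @kweight_FE _ _ _ _ _ q_neq0 _ i a v) m kw.
  rewrite addNr qnum0 mulr0 scale0r addr0 (hw_E hw) => <-.
  by rewrite iter_linear0.
have EF v : actE V j (actF V i v) = actF V i (actE V j v).
  by apply/eqP; rewrite -subr_eq0 act_EF (negPf ji).
have -> : forall k, actE V j (iter k (actF V i) v0) = iter k (actF V i) (actE V j v0).
  by elim=> //= k <-; rewrite EF.
by rewrite (hw_E hw) iter_linear0.
Qed.

(** Such a component would come from weight $\lambda-(m+1)\alpha_i$, whose weight space is spanned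
    by $F_i^{m+1}v_0=0$. Transposed, this is integrability of the graded dual. *)
Lemma hw_no_string i m (v : V) : coroot i lam = m%:Z ->
  wproj lam (iter m.+1 (actE V i) v) = 0.
Proof.
move=> hm; have -> : forall k x, wproj x (iter k (actE V i) v) =
    iter k (actE V i) (wproj (x - alpha i *+ k) v).
  elim=> [|k IH] x; first by rewrite subr0.
  by rewrite iterS wproj_E // IH -iterS mulrS opprD addrA.
have [c ->] := hw_string q_neq0 hw rho_gt0 i m.+1 v.
by rewrite hw_integrable // scaler0 iter_linear0.
Qed.

(** A nonzero component of weight other than [lam] is not singular, so some $E_i$ raises it to a
    nonzero one; since heights are bounded by that of [lam], this ends at [lam]. *)
Lemma hw_separate (v : V) : v != 0 ->
  exists w : seq 'I_n, wproj lam (foldr (fun i => actE V i) v w) != 0.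
Proof.
move=> /wproj_neq0[x hx].
have [k] : exists k : nat, hgt lam < hgt x + k%:Z.
  by exists `|hgt lam - hgt x|.+1; lia.
elim: k x v hx => [|k IH] x v hx hk.
  by rewrite addr0 in hk; rewrite (hw_above q_neq0 hw rho_gt0) ?eqxx in hx.
have [e|xlam] := eqVneq x lam; first by exists [::]; rewrite /= -e.
have [i hi] : exists i, actE V i (wproj x v) != 0.
  apply: contrapT => h; case/eqP: hx.
  apply: (hw_singular (wproj_wt x v)) => // i.
  by apply/eqP/negPn/negP => hi; apply: h; exists i.
have [||w hw'] := IH (x + alpha i) (actE V i v).
- by rewrite wproj_E // addrK.
- by rewrite wformDl; have := rho_gt0 i; lia.
by exists (rcons w i); rewrite foldr_rcons.
Qed.

End IrreducibleHighestWeight.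

(** * The graded dual *)

Section Density.
Variables (L : fieldType) (W V : lmodType L) (pair : {bilinear W -> V -> L^o}).
Variable T : W -> Prop.
Hypotheses (T0 : T 0) (Tlin : forall a u v, T u -> T v -> T (a *: u + v))
  (Tsep : forall y, (forall h, T h -> pair h y = 0) -> y = 0).

Lemma separating_biorthogonal (ys : seq V) y :
  (forall h, T h -> (forall z, z \in ys -> pair h z = 0) -> pair h y = 0) ->
  forall g, (forall z, z \in ys -> pair g z = 0) -> pair g y = 0.
Proof.
elim: ys y => [|y1 ys IH] y hT g hg.
  by rewrite (Tsep (y := y)) ?linear0r // => h /hT; apply.
have [[h0 [Th0 h0s h0y]]|no] :=
    pselect (exists h, [/\ T h, forall z, z \in ys -> pair h z = 0 & pair h y1 != 0]).
  have hys z : z \in ys -> pair g z = 0 by move=> hz; apply: hg; rewrite inE hz orbT.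
  have : pair g (y - (pair h0 y / pair h0 y1) *: y1) = 0.
    apply: IH hys => h Th hs.
    have := hT (- (pair h y1 / pair h0 y1) *: h0 + h) (Tlin _ Th0 Th).
    rewrite linearBr linearZr_LR linearPl /= => h1.
    rewrite -[RHS]h1 => [|z].
      rewrite /GRing.scale /=; field; exact: h0y.
    rewrite inE linearPl /= => /orP[/eqP ->|hz].
      by rewrite /GRing.scale /= mulNr divfK // addNr.
    by rewrite (h0s z) // (hs z) // scaler0 addr0.
  by rewrite linearBr linearZr_LR /= (hg y1) ?inE ?eqxx // scaler0 subr0.
apply: (IH y) => [h Th hs|z hz]; last by apply: hg; rewrite inE hz orbT.
apply: hT => // z; rewrite inE => /orP[/eqP ->|]; last exact: hs.
by apply/eqP/negPn/negP => h1; apply: no; exists h.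
Qed.

(** If the interpolant [h] for the tail is wrong at [y], then [separating_biorthogonal] for [g - h]
    gives an element of [T] that vanishes on the tail and not at [y]; a multiple of it corrects
    [h]. *)
Lemma separating_interpolation (ys : seq V) g :
  exists2 h, T h & forall y, y \in ys -> pair h y = pair g y.
Proof.
elim: ys => [|y ys [h Th hs]]; first by exists 0.
have [e|ne] := eqVneq (pair h y) (pair g y).
  by exists h => // z; rewrite inE => /orP[/eqP ->|/hs].
have [h1 [Th1 h1s h1y]] :
    exists h1, [/\ T h1, forall z, z \in ys -> pair h1 z = 0 & pair h1 y != 0].
  apply: contrapT => no; case/eqP: ne; apply/esym/eqP; rewrite -subr_eq0 -linearBl.
  apply/eqP; apply: (separating_biorthogonal (ys := ys)) => [h1 Th1 h1s|z hz].
    by apply/eqP/negPn/negP => h1y; apply: no; exists h1.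
  by rewrite linearBl hs // subrr.
exists (((pair g y - pair h y) / pair h1 y) *: h1 + h); first exact: Tlin.
move=> z; rewrite inE linearPl /= => /orP[/eqP ->|hz].
  by rewrite /GRing.scale /= divfK // subrK.
by rewrite (h1s z) // (hs z) // scaler0 add0r.
Qed.

End Density.

(** * The lowest weight vector of the graded dual *)

Section HighestWeightFunctional.
Variables (L : fieldType) (q : L) (n : nat) (A : 'M[int]_n) (D : weight_data A).
Hypotheses (q_neq0 : q != 0) (q_nonroot : forall k, (0 < k)%N -> q ^+ k != 1).
Variables (V : weight_module q D) (mu : weight D) (v0 : V).
Hypothesis hw : is_highest_weight_vector mu v0.
Local Notation alpha := (simple_root D).
Variable rho : weight D.
Hypothesis rho_gt0 : forall i, 0 < wform (alpha i) rho.

Lemma hw_functional : exists phi : {linear V -> L^o}, forall v, wproj mu v = phi v *: v0.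
Proof.
pose phi v := sval (cid (hw_line q_neq0 hw rho_gt0 v)).
have phiP v : wproj mu v = phi v *: v0 := svalP (cid (hw_line q_neq0 hw rho_gt0 v)).
have lphi : linear (phi : V -> L^o).
  move=> a u v; apply/eqP; rewrite -subr_eq0.
  have : (phi (a *: u + v) - (a * phi u + phi v)) *: v0 == 0.
    by rewrite scalerBl scalerDl -scalerA -!phiP linearP subrr.
  by rewrite scaler_eq0 (negPf (hw_neq0 hw)) orbF.
pose lin := GRing.isLinear.Build L V L^o *:%R (phi : V -> L^o) lphi.
by exists (HB.pack_for {linear V -> L^o} (phi : V -> L^o) lin).
Qed.

Variables (W : Uq_module q D) (pair : {bilinear W -> V -> L^o}).
Hypothesis gd : is_graded_dual pair.

Lemma gdual_KV i f v : pair (actKV W i f) v = pair f (actK V i v).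
Proof. by rewrite -{2}(act_KKV i f) (gdual_K gd) act_KVK. Qed.

Lemma gdual_eq f g : (forall v, pair f v = pair g v) -> f = g.
Proof.
by move=> h; apply/eqP; rewrite -subr_eq0; apply/eqP/(gdual_inj gd) => v; rewrite linearBl h subrr.
Qed.

Lemma gdual_proj x h : exists h', forall v, pair h' v = pair h (wproj x v).
Proof.
apply: (gdual_surj gd (phi := pair h \o wproj x : {linear V -> L^o})).
exists [:: x] => y; rewrite inE eq_sym => /negPf yx v hv /=.
by rewrite (wproj_wtspace _ hv) yx linear0r.
Qed.

(** The coordinate along [v0], which is the lowest weight vector of $L^*(\mu)$, of weight $-\mu$. *)
Definition is_lowest_weight_functional (f : W) : Prop :=
  forall v, wproj mu v = pair f v *: v0.

Lemma lowest_weight_functional_exists : exists f, is_lowest_weight_functional f.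
Proof.
have [phi phiP] := hw_functional; have [|f hf] := gdual_surj gd (phi := phi).
  exists [:: mu] => x; rewrite inE eq_sym => /negPf yx v hv; have := phiP v.
  rewrite (wproj_wtspace _ hv) yx => /esym/eqP.
  by rewrite scaler_eq0 (negPf (hw_neq0 hw)) orbF => /eqP.
by exists f => v; rewrite hf.
Qed.

Variable f : W.
Hypothesis fP : is_lowest_weight_functional f.

Lemma scale_v0_inj (a b : L) : a *: v0 = b *: v0 -> a = b.
Proof.
move/eqP; rewrite -subr_eq0 -scalerBl scaler_eq0 (negPf (hw_neq0 hw)) orbF subr_eq0.
by move/eqP.
Qed.

Lemma lowest_v0 : pair f v0 = 1.
Proof. by apply: scale_v0_inj; rewrite -fP (wproj_id (hw_weight hw)) scale1r. Qed.

Lemma lowest_F i : actF W i f = 0.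
Proof.
apply: gdual_eq => v; rewrite (gdual_F gd) linear0l; apply/eqP; rewrite oppr_eq0; apply/eqP.
apply: scale_v0_inj; rewrite -fP wproj_F // (hw_above q_neq0 hw rho_gt0) ?linear0 ?scale0r //.
by rewrite wformDl ltrDl.
Qed.

Lemma lowest_scalar_K i v : pair f (actK V i v) = q ^ (2 * wform (alpha i) mu) * pair f v.
Proof.
apply: scale_v0_inj; rewrite -fP wproj_K // fP linearZ /= (wtspace_K _ (hw_weight hw)).
by rewrite !scalerA mulrC.
Qed.

Lemma lowest_scalar_KV i v :
  pair f (actKV V i v) = (q ^ (2 * wform (alpha i) mu))^-1 * pair f v.
Proof.
apply: scale_v0_inj; rewrite -fP wproj_KV // fP linearZ /=.
by rewrite (wtspace_KV q_neq0 _ (hw_weight hw)) !scalerA mulrC.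
Qed.

Lemma lowest_K i : actK W i f = (q ^ (2 * wform (alpha i) mu))^-1 *: f.
Proof. by apply: gdual_eq => v; rewrite (gdual_K gd) lowest_scalar_KV linearZl_LR. Qed.

Lemma lowest_KV i : actKV W i f = q ^ (2 * wform (alpha i) mu) *: f.
Proof. by apply: gdual_eq => v; rewrite gdual_KV lowest_scalar_K linearZl_LR. Qed.

(** The antipode sends $E_i$ to $-K_i^{-1}E_i$; the factors $K_i^{-1}$ can be moved next to [f] at
    the cost of scalars, and [f] absorbs them up to a scalar. *)
Lemma lowest_iter_E i k : exists c : L, forall v,
  pair (iter k (actE W i) f) v = c * pair f (iter k (actE V i) v).
Proof.
have EKV m : exists c, forall v : V,
    iter m (actE V i) (actKV V i v) = c *: actKV V i (iter m (actE V i) v).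
  elim: m => [|m [c e]]; first by exists 1 => v; rewrite scale1r.
  exists (c * q ^ (2 * wform (alpha i) (alpha i))) => v.
  rewrite iterS e linearZ /= actKV_E // scalerA mulfK ?expfz_neq0 //.
elim: k => [|k [c IH]]; first by exists 1 => v; rewrite mul1r.
have [c' e] := EKV k.
exists (- (c * c' * (q ^ (2 * wform (alpha i) mu))^-1)) => v.
rewrite iterS (gdual_E gd) IH e linearZr_LR /= lowest_scalar_KV -iterSr.
by rewrite /GRing.scale /= mulNr !mulrA.
Qed.

Hypothesis irr : irreducible V.

Lemma lowest_integrable i m : coroot i mu = m%:Z -> iter m.+1 (actE W i) f = 0.
Proof.
move=> hm; apply: gdual_eq => v; have [c ->] := lowest_iter_E i m.+1; rewrite linear0l.
have -> : pair f (iter m.+1 (actE V i) v) = 0; last by rewrite mulr0.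
by apply: scale_v0_inj; rewrite -fP (hw_no_string q_neq0 q_nonroot hw rho_gt0 irr) // scale0r.
Qed.

Local Notation T := (opspan (fun i => actE W i : W -> W) f).

Lemma lowest_span_submodule : Uq_submodule T.
Proof.
apply: (opspan_E_submodule q_neq0) => i; last exact: lowest_F.
  by eexists; apply: lowest_K.
by eexists; apply: lowest_KV.
Qed.

(** The common kernel of the functionals in [T] is a submodule of [V] that does not contain [v0], as
    [pair f v0] is 1; it is zero by irreducibility. *)
Lemma lowest_span_separates y : (forall h, T h -> pair h y = 0) -> y = 0.
Proof.
have [T0 Tl TE TF TK TKV] := lowest_span_submodule.
have hS : Uq_submodule (fun y => forall h, T h -> pair h y = 0).
  split=> [h _|a u v hu hv h Th|i v hv h Th|i v hv h Th|i v hv h Th|i v hv h Th].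
  - exact: linear0r.
  - by rewrite linearPr hu // hv // scaler0 addr0.
  (* The element $E_iK_i^{-1}$ acts on functionals as minus the transpose of $E_i$, and $K_iF_i$ as
     minus the transpose of $F_i$. *)
  - have := hv _ (TE i _ (TKV i _ Th)); rewrite (gdual_E gd) gdual_KV act_KKV.
    by move/eqP; rewrite oppr_eq0 => /eqP.
  - have := hv _ (TK i _ (TF i _ Th)); rewrite (gdual_K gd) (gdual_F gd) act_KKV.
    by move/eqP; rewrite oppr_eq0 => /eqP.
  - by rewrite -gdual_KV; apply/hv/TKV.
  - by rewrite -(gdual_K gd); apply/hv/TK.
have [h|/(_ v0 f (opspan_gen _ _))/eqP] := irr.2 _ hS; first exact: h.
by rewrite lowest_v0 oner_eq0.
Qed.

(** The span is graded because [f] is homogeneous and each $E_i$ shifts weights. *)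
Lemma lowest_span_proj x h h' : T h -> (forall v, pair h' v = pair h (wproj x v)) -> T h'.
Proof.
move=> Th; elim: Th x h' => [||a u v _ IHu _ IHv|i u _ IH] x h' e.
- have [ex|nx] := eqVneq x mu.
    have -> : h' = f; last exact: opspan_gen.
    apply: gdual_eq => v; rewrite e ex; apply: scale_v0_inj.
    by rewrite -!fP (wproj_id (wproj_wt _ _)).
  have -> : h' = 0; last exact: opspan_0.
  apply: gdual_eq => v; rewrite e linear0l; apply: scale_v0_inj.
  by rewrite -fP (wproj_wtspace _ (wproj_wt _ _)) eq_sym (negPf nx) scale0r.
- have -> : h' = 0; last exact: opspan_0.
  by apply: gdual_eq => v; rewrite e !linear0l.
- have [u' hu] := gdual_proj x u; have [v' hv] := gdual_proj x v.
  have -> : h' = a *: u' + v'; last by apply: opspan_lin; [apply: IHu hu|apply: IHv hv].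
  by apply: gdual_eq => w; rewrite e !linearPl hu hv.
have [u' hu] := gdual_proj (x + alpha i) u.
have -> : h' = actE W i u'; last by apply: opspan_op; apply: IH hu.
apply: gdual_eq => w; rewrite e !(gdual_E gd) hu wproj_KV // wproj_E // addrK.
by [].
Qed.

(** Thus $L^*(\mu)=U^+f$. A functional of a single weight is determined by finitely many values;
    some element of the separating span has the same values, and its part of this weight lies in the
    span again. *)
Lemma lowest_span_full g : T g.
Proof.
have [T0 Tl _ _ _ _] := lowest_span_submodule.
have single x h : (forall v, pair h v = pair h (wproj x v)) -> T h.
  move=> hx; have [ys hys] := hw_finitely_determined q_neq0 hw rho_gt0 x.
  have [h1 Th1 e1] := separating_interpolation T0 Tl lowest_span_separates
    [seq wproj x y | y <- ys] h.
  have [h2 e2] := gdual_proj x h1.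
  suff -> : h = h2 by apply: lowest_span_proj Th1 e2.
  apply: gdual_eq => v; rewrite hx e2; apply/eqP.
  rewrite -[pair h1 _](_ : pair h2 (wproj x v) = _); last first.
    by rewrite e2 (wproj_id (wproj_wt _ _)).
  rewrite -subr_eq0 -linearBl; apply/eqP.
  apply: (hys (pair (h - h2) : {linear V -> L^o})) (wproj_wt x v) => y hy /=.
  by rewrite linearBl e2 e1 -?hx ?subrr // map_f.
(* A general functional lives on finitely many weights, which are split off one at a time. *)
have [s] := gdual_graded gd g; elim: s g => [|x s IH] g hs.
  suff -> : g = 0 by [].
  apply: gdual_eq => v; have [t [_ _ ->]] := wproj_supp v.
  rewrite linear_sumr linear0l big1 // => y _; by rewrite (hs y _ _ (wproj_wt y v)).
have [g' eg'] := gdual_proj x g.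
rewrite -(subrK g' g) -[g - g']scale1r; apply: Tl; last first.
  by apply: (single x) => v; rewrite !eg' (wproj_id (wproj_wt _ _)).
apply: IH => y hy v hv; rewrite linearBl eg'.
have [exy|xy] := eqVneq x y; first by rewrite exy (wproj_id hv) subrr.
rewrite (wproj_wtspace _ hv) (negPf xy) linear0r subr0; apply: hs hv.
by rewrite inE negb_or eq_sym xy.
Qed.

Lemma lowest_ind (P : W -> Prop) : P f -> P 0 ->
  (forall a u v, P u -> P v -> P (a *: u + v)) -> (forall i v, P v -> P (actE W i v)) ->
  forall v, P v.
Proof. by move=> Pf P0 Pl PE v; elim: (lowest_span_full v) => //; auto. Qed.

End HighestWeightFunctional.

(** * Tensor products and scalar extensions *)

(** The closure properties are bundled so that the elements form an [lmodType], to serve as target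
    in universal properties. *)
Record subspace (L : fieldType) (V : lmodType L) := Subspace {
  in_subspace :> V -> Prop;
  subspace0 : in_subspace 0;
  subspace_lin : forall a u v, in_subspace u -> in_subspace v -> in_subspace (a *: u + v)
}.

Section SubspaceType.
Variables (L : fieldType) (V : lmodType L) (S : subspace V).

Definition subspace_pred : {pred V} := fun v => `[< S v >].

Lemma subspace_predP v : reflect (S v) (v \in subspace_pred).
Proof. exact: asboolP. Qed.

Lemma subspace_submod_closed : submod_closed subspace_pred.
Proof.
split=> [|a u v /asboolP hu /asboolP hv]; apply/asboolP; first exact: subspace0.
exact: subspace_lin.
Qed.

HB.instance Definition _ :=
  GRing.isSubmodClosed.Build L V subspace_pred subspace_submod_closed.

Record subspace_type := SubspaceElt { subspace_val :> V; _ : subspace_val \in subspace_pred }.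

HB.instance Definition _ := [isSub for subspace_val].
HB.instance Definition _ := [Choice of subspace_type by <:].
HB.instance Definition _ := [SubChoice_isSubLmodule of subspace_type by <:].

Definition subspace_mk v (h : S v) : subspace_type := SubspaceElt (introT (subspace_predP v) h).

Lemma subspace_valP (u : subspace_type) : S (\val u).
Proof. by case: u => v hv; apply/subspace_predP. Qed.

End SubspaceType.

Section TensorSpan.
Variables (L : fieldType) (q : L) (n : nat) (A : 'M[int]_n) (D : weight_data A).
Variables (V W U : Uq_module q D) (t : {bilinear V -> W -> U}).
Hypothesis tP : is_tensor_module t.
Variables (S : subspace U) (hS : forall v w, S (t v w)).

Definition corestrict_tensor v w : subspace_type S := subspace_mk (hS v w).

Lemma corestrict_tensor_is_bilinear : bilinear_for *:%R *:%R corestrict_tensor.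
Proof.
by split=> [w a u v|v a u w]; apply: val_inj; rewrite /= ?linearPl ?linearPr.
Qed.

HB.instance Definition _ := bilinear_isBilinear.Build L V W (subspace_type S) *:%R *:%R
  corestrict_tensor corestrict_tensor_is_bilinear.

(* Pure tensors span: the universal property gives a retraction of U onto the
   subspace [S], which is the identity by uniqueness. *)
Lemma tensor_subspace_full u : S u.
Proof.
have [g [gt _]] := tensor_universal tP corestrict_tensor.
have [g0 [_ uniq]] := tensor_universal tP t.
have e1 : \val (g u) = g0 u.
  apply: (uniq (\val \o g : {linear U -> U})) => v w /=; by rewrite gt.
have e2 : u = g0 u := uniq (idfun : {linear U -> U}) (fun _ _ => erefl) u.
by rewrite e2 -e1; apply: subspace_valP.
Qed.

End TensorSpan.

Section ExtensionSpan.
Variables (K L : fieldType) (phi : {rmorphism K -> L}) (q : K).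
Variables (n : nat) (A : 'M[int]_n) (D : weight_data A).
Variables (V : Uq_module q D) (X : Uq_module (phi q) D).
Variable iota : {linear V -> X | phi \; *:%R}.
Hypothesis eP : is_scalar_extension iota.
Variables (S : subspace X) (hS : forall v, S (iota v)).

Definition corestrict_iota v : subspace_type S := subspace_mk (hS v).

Lemma corestrict_iota_is_linear :
  GRing.linear_for (phi \; *:%R : K -> subspace_type S -> subspace_type S) corestrict_iota.
Proof. by move=> a u v; apply: val_inj; rewrite /= linearP. Qed.

HB.instance Definition _ := GRing.isLinear.Build K V (subspace_type S) (phi \; *:%R)
  corestrict_iota corestrict_iota_is_linear.

(** As for tensors: the map into [S] from the universal property, followed by the inclusion, is the
    identity by uniqueness. *)
Lemma extension_subspace_full u : S u.
Proof.
have [g [gt _]] := ext_universal eP corestrict_iota.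
have [g0 [_ uniq]] := ext_universal eP iota.
have e1 : \val (g u) = g0 u.
  apply: (uniq (\val \o g : {linear X -> X})) => v /=; by rewrite gt.
have e2 : u = g0 u := uniq (idfun : {linear X -> X}) (fun _ => erefl) u.
by rewrite e2 -e1; apply: subspace_valP.
Qed.

End ExtensionSpan.

(** * Tensors as operators through contraction *)

Section Contraction.
Variables (L : fieldType) (V W Z : lmodType L) (pair : {bilinear W -> Z -> L^o}).

Definition contraction_of z (v : V) (f : W) : V := (pair f z : L) *: v.

Lemma contraction_of_is_bilinear z : bilinear_for *:%R *:%R (contraction_of z).
Proof.
split=> [f a u v|v a f g]; rewrite /contraction_of.
  by rewrite /= scalerDr !scalerA mulrC.
by rewrite linearPl /= scalerDl scalerA.
Qed.

HB.instance Definition _ z := bilinear_isBilinear.Build L V W V *:%R *:%R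
  (contraction_of z) (contraction_of_is_bilinear z).

End Contraction.

Section TensorWithDual.
Variables (L : fieldType) (q : L) (n : nat) (A : 'M[int]_n) (D : weight_data A).
Hypotheses (q_neq0 : q != 0) (q_nonroot : forall k, (0 < k)%N -> q ^+ k != 1).
Variables (V Z : weight_module q D) (W U : Uq_module q D).
Variables (pair : {bilinear W -> Z -> L^o}) (t : {bilinear V -> W -> U}).
Hypotheses (gd : is_graded_dual pair) (tP : is_tensor_module t).
Local Notation alpha := (simple_root D).

Lemma tensor_ind (P : U -> Prop) : P 0 ->
  (forall a u v, P u -> P v -> P (a *: u + v)) -> (forall v w, P (t v w)) -> forall u, P u.
Proof. by move=> P0 Pl Pt u; apply: (tensor_subspace_full tP (S := Subspace P0 Pl)). Qed.

(** [c z u] is the value at [z] of the operator from [Z] to [V] that the tensor [u] represents. *)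
Lemma contraction_exists : exists c : Z -> {linear U -> V},
  forall z v f, c z (t v f) = (pair f z : L) *: v.
Proof.
have h z := tensor_universal tP (contraction_of pair z : {bilinear V -> W -> V}).
exists (fun z => sval (cid (h z))) => z v f.
by have [-> _] := svalP (cid (h z)).
Qed.

Variable c : Z -> {linear U -> V}.
Hypothesis cP : forall z v f, c z (t v f) = (pair f z : L) *: v.

Lemma contraction_linear u a y z : c (a *: y + z) u = a *: c y u + c z u.
Proof.
elim/tensor_ind: u => [|b u v IHu IHv|v f]; first by rewrite !linear0 addr0.
  by rewrite !linearP /= IHu IHv !scalerDr !scalerA mulrC addrACA.
by rewrite !cP linearPr scalerDl scalerA.
Qed.

Lemma contraction0 u : c 0 u = 0.
Proof. by have := contraction_linear u (-1) 0 0; rewrite scaler0 addr0 scaleN1r addNr. Qed.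

Lemma contractionZ u a z : c (a *: z) u = a *: c z u.
Proof. by rewrite -[a *: z]addr0 contraction_linear contraction0 addr0. Qed.

(** The second term of the coproduct acts on the functional, hence on [z] through the antipode; this
    gives the minus sign, here and for $F_i$. *)
Lemma contraction_E i u z :
  c z (actE U i u) = actE V i (c z u) - actK V i (c (actKV Z i (actE Z i z)) u).
Proof.
elim/tensor_ind: u => [|a u v IHu IHv|v f]; first by rewrite !linear0 ?subr0 ?addr0.
  by rewrite !linearP /= IHu IHv scalerDr addrACA.
rewrite (tensor_E tP) linearD /= !cP (gdual_E gd) !linearZ /= scaleNr.
by rewrite scalerN.
Qed.

Lemma contraction_F i u z :
  c z (actF U i u) = actF V i (c (actK Z i z) u) - c (actF Z i (actK Z i z)) u.
Proof.
elim/tensor_ind: u => [|a u v IHu IHv|v f]; first by rewrite !linear0 ?subr0 ?addr0.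
  by rewrite !linearP /= IHu IHv scalerDr addrACA.
by rewrite (tensor_F tP) linearD /= !cP (gdual_F gd) (gdual_KV gd) !linearZ /= scaleNr scalerN.
Qed.

Lemma tensor_repr u : exists s : seq (V * W), u = \sum_(p <- s) t p.1 p.2.
Proof.
elim/tensor_ind: u => [|a u v [s1 ->] [s2 ->]|v f].
- by exists [::]; rewrite big_nil.
- exists ([seq (a *: p.1, p.2) | p <- s1] ++ s2); rewrite big_cat big_map scaler_sumr.
  by congr (_ + _); apply: eq_bigr => p _; rewrite linearZl_LR.
by exists [:: (v, f)]; rewrite big_seq1.
Qed.

(** Induction on the number of pure tensors. If the first functional is nonzero at some [z0], the
    vanishing at [z0] expresses the first vector through the others, and substitution shortens the
    sum. *)
Lemma contraction_inj u : (forall z, c z u = 0) -> u = 0.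
Proof.
have [s ->] := tensor_repr u => {u} cs.
have {}cs z : \sum_(p <- s) (pair p.2 z : L) *: p.1 = 0.
  by rewrite -[RHS](cs z) linear_sum; apply: eq_bigr => p _; rewrite cP.
have [k] := ubnP (size s); elim: k s cs => // k IH [|[v f] s] cs /= hk.
  by rewrite big_nil.
have [f0|f0] := pselect (forall z, pair f z = 0).
  rewrite big_cons /= (gdual_inj gd f0) linear0r add0r; apply: IH => // z.
  by have := cs z; rewrite big_cons /= f0 scale0r add0r.
have [z0 hz0] : exists z, pair f z != 0.
  by apply: contrapT => no; apply: f0 => z; apply/eqP/negPn/negP => h; apply: no; exists z.
pose a (p : V * W) : L := pair p.2 z0 / pair f z0.
have ev : v = - \sum_(p <- s) a p *: p.1.
  have := cs z0; rewrite big_cons /= => /eqP; rewrite addr_eq0 => /eqP e.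
  rewrite -[LHS](scalerK hz0) e scalerN scaler_sumr; congr (- _).
  by apply: eq_bigr => p _; rewrite scalerA mulrC.
have key (B : {bilinear V -> W -> U}) :
    \sum_(p <- (v, f) :: s) B p.1 p.2 = \sum_(p <- [seq (p.1, p.2 - a p *: f) | p <- s]) B p.1 p.2.
  rewrite big_cons big_map /= [in B v _]ev linearNl linear_sumlz -sumrN -big_split.
  by apply: eq_bigr => p _ /=; rewrite linearBr linearZl_LR linearZr_LR addrC.
rewrite key; apply: IH => [z|]; last by rewrite size_map.
rewrite -[RHS](cs z) big_cons big_map /= [X in _ *: X + _]ev scalerN scaler_sumr -sumrN -big_split.
apply: eq_bigr => p _ /=; rewrite linearBl linearZl_LR scalerBl addrC scalerA.
by rewrite /GRing.scale /= [a p * _]mulrC.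
Qed.

Lemma contraction_supp u : exists s : seq (weight D * weight D),
  forall x y z, (x, y) \notin s -> wproj x (c (wproj y z) u) = 0.
Proof.
elim/tensor_ind: u => [|a u v [s1 h1] [s2 h2]|v f].
- by exists [::] => x y z _; rewrite !linear0.
- exists (s1 ++ s2) => x y z; rewrite mem_cat negb_or => /andP[n1 n2].
  by rewrite !linearP /= h1 // h2 // scaler0 addr0.
have [sv [_ hv _]] := wproj_supp v; have [sf hf] := gdual_graded gd f.
exists [seq (x, y) | x <- sv, y <- sf] => x y z xy; rewrite cP linearZ /=.
have [hx|/hv->] := boolP (x \in sv); last by rewrite scaler0.
have [hy|/hf-> //] := boolP (y \in sf); last exact: wproj_wt; last exact: scale0r.
by case/negP: xy; apply/allpairsP; exists (x, y).
Qed.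

End TensorWithDual.

(** * Leading components *)

Section Precomposition.
Variables (L : fieldType) (Z V : lmodType L).

Definition precomp (T : Z -> Z) (Psi : Z -> V) : Z -> V := Psi \o T.

Lemma precomp_is_linear T : linear (precomp T).
Proof. by []. Qed.

HB.instance Definition _ T :=
  GRing.isLinear.Build L (Z -> V) (Z -> V) *:%R (precomp T) (precomp_is_linear T).

Lemma iter_precomp T k Psi z : iter k (precomp T) Psi z = Psi (iter k T z).
Proof. by elim: k z => //= k IH z; rewrite /precomp /= IH -iterSr. Qed.

End Precomposition.

Section LeadingComponent.
Variables (L : fieldType) (q : L) (n : nat) (A : 'M[int]_n) (D : weight_data A).
Hypotheses (q_neq0 : q != 0) (q_nonroot : forall k, (0 < k)%N -> q ^+ k != 1).
Variables (V Z : weight_module q D) (W U : Uq_module q D).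
Variables (pair : {bilinear W -> Z -> L^o}) (t : {bilinear V -> W -> U}).
Hypotheses (gd : is_graded_dual pair) (tP : is_tensor_module t).
Local Notation alpha := (simple_root D).
Variable rho : weight D.
Hypothesis rho_gt0 : forall i, 0 < wform (alpha i) rho.
Local Notation hgt x := (wform x rho).
Variable c : Z -> {linear U -> V}.
Hypothesis cP : forall z v f, c z (t v f) = (pair f z : L) *: v.

(** The part of [u] that maps weight [y] of [Z] to weight [x] of [V] is its component of weight
    $(x,-y)$. For $x=\lambda-\beta$, $y=\mu-\gamma$, small total height means large
    $\mathrm{ht}(\beta)+\mathrm{ht}(\gamma)$. *)
Definition vanishes_below (d : int) (u : U) : Prop :=
  forall x y z, wtspace y z -> hgt x + hgt y < d -> wproj x (c z u) = 0.

(* On the components of lowest total height only [F_i (x) K_i^-1] survives in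
   the coproduct of [F_i ^ k], as [1 (x) F_i] comes from components below; for
   [E_i ^ k] it is [K_i (x) E_i]. *)
Lemma leading_F d u i k : vanishes_below d u ->
  vanishes_below (d - hgt (alpha i) *+ k) (iter k (actF U i) u) /\
  forall x y z, wtspace y z -> hgt x + hgt y = d ->
    exists2 a, a != 0 & wproj (x - alpha i *+ k) (c z (iter k (actF U i) u)) =
                        a *: iter k (actF V i) (wproj x (c z u)).
Proof.
move=> hd; elim: k => [|k [IH1 IH2]].
  rewrite subr0; split=> // x y z hz hxy; exists 1; rewrite ?oner_neq0 //.
  by rewrite subr0 scale1r.
have r0 := rho_gt0 i.
have Kw y z : wtspace y z -> wtspace y (actK Z i z).
  by move=> hz; rewrite (wtspace_K _ hz); apply: wtspaceZ.
split=> [x y z hz hxy|x y z hz hxy]; rewrite iterS (contraction_F gd tP cP) linearB /= wproj_F //.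
  rewrite (IH1 _ _ _ (Kw _ _ hz)) ?linear0 ?sub0r; last first.
    by rewrite wformDl; rewrite mulrS in hxy; lia.
  rewrite (IH1 _ _ _ (wtspace_F i (Kw _ _ hz))) ?oppr0 //.
  by rewrite wformDl wformNl; rewrite mulrS in hxy; lia.
have [a a0 e] := IH2 _ _ _ hz hxy.
rewrite (IH1 _ _ _ (wtspace_F i (Kw _ _ hz))) ?subr0; last first.
  by rewrite !wformDl !wformNl wformMnl -hxy mulrS; lia.
rewrite mulrSr opprD addrA subrK (wtspace_K _ hz) (contractionZ tP cP) linearZ /= e.
exists (q ^ (2 * wform (alpha i) y) * a); first by rewrite mulf_neq0 // expfz_neq0.
by rewrite !linearZ /= scalerA.
Qed.

Lemma leading_E d u i k : vanishes_below d u ->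
  vanishes_below (d - hgt (alpha i) *+ k) (iter k (actE U i) u) /\
  forall x y z, wtspace (y - alpha i *+ k) z -> hgt x + hgt y = d ->
    exists2 a, a != 0 & wproj x (c z (iter k (actE U i) u)) =
                        a *: wproj x (c (iter k (actE Z i) z) u).
Proof.
move=> hd; elim: k => [|k [IH1 IH2]].
  rewrite subr0; split=> // x y z hz hxy; exists 1; rewrite ?oner_neq0 //.
  by rewrite scale1r.
have r0 := rho_gt0 i.
split=> [x y z hz hxy|x y z hz hxy];
  rewrite iterS (contraction_E gd tP cP) linearB /= wproj_E // wproj_K //.
  rewrite (IH1 _ _ _ hz) ?linear0 ?sub0r; last first.
    by rewrite wformDl wformNl; rewrite mulrS in hxy; lia.
  rewrite (wtspace_KV q_neq0 _ (wtspace_E i hz)) (contractionZ tP cP).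
  rewrite [wproj x _]linearZ /= (IH1 _ _ _ (wtspace_E i hz)) ?scaler0 ?linear0 ?oppr0 //.
  by rewrite wformDl; rewrite mulrS in hxy; lia.
have hEz : wtspace (y - alpha i *+ k) (actE Z i z).
  by have := wtspace_E i hz; rewrite mulrSr opprD addrA subrK.
have [a a0 e] := IH2 _ _ _ hEz hxy.
rewrite (IH1 (x - alpha i) _ _ hz) ?linear0 ?sub0r; last first.
  by rewrite !wformDl !wformNl wformMnl -hxy mulrS; lia.
rewrite (wtspace_KV q_neq0 _ hEz) (contractionZ tP cP) linearZ /= e.
rewrite !linearZ /= (wtspace_K i (wproj_wt x _)) -iterS iterSr !scalerA -scaleNr.
rewrite scalerA; eexists; last reflexivity.
by rewrite mulf_neq0 ?oppr_eq0 ?mulf_neq0 ?invr_neq0 ?expfz_neq0.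
Qed.

Variables (lam mu : weight D) (v0 : V) (z0 : Z).
Hypotheses (hwV : is_highest_weight_vector lam v0) (hwZ : is_highest_weight_vector mu z0).
Hypotheses (irrV : irreducible V) (A_type : affine_type A \/ indefinite_type A).
Variables (ml mm : 'I_n -> nat).
Hypotheses (mlP : forall i, coroot i lam = (ml i)%:Z) (mmP : forall i, coroot i mu = (mm i)%:Z).
Variable u : U.
Hypotheses (Fu : forall i, iter (ml i).+1 (actF U i) u = 0)
           (Eu : forall i, iter (mm i).+1 (actE U i) u = 0).

Section Component.
Variables (x y : weight D).
Hypothesis hd : vanishes_below (hgt x + hgt y) u.
Let Phi z := wproj x (c (wproj y z) u).

Let Phi_lin : linear Phi.
Proof. by move=> a z1 z2; rewrite /Phi linearP /= (contraction_linear tP cP) linearP. Qed.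

(** As $F_i$ to the power [(ml i).+1] kills [u], its leading term shows that this power kills
    [Phi z]; so [sl2_string] applies in [V]. *)
Lemma component_left i z : Phi z != 0 ->
  coroot i x < (ml i).+1%:Z /\ (coroot i x + 1 = (ml i).+1%:Z -> actE V i (Phi z) = 0).
Proof.
have hPhi : wtspace x (Phi z) by apply: wproj_wt.
apply: (sl2_string (qd_neq0 D q_neq0 i) (qd_gen D q_neq0 q_nonroot i)
  (@kweight_E _ _ _ _ _ q_neq0 V i) (@kweight_F _ _ _ _ _ q_neq0 V i)
  (@kweight_EF _ _ _ _ _ q_neq0 V i) (wtspace_kweight i hPhi)).
  exact: (hw_E_nilpotent q_neq0 hwV rho_gt0 i hPhi).
have [_ h] := leading_F i (ml i).+1 hd.
have [a a0] := h x y (wproj y z) (wproj_wt y z) erefl.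
rewrite Fu !linear0 => /esym/eqP; rewrite scaler_eq0 (negPf a0) => /eqP; exact.
Qed.

(* Precomposition with [F_i] and [E_i] satisfies the relations of [E_i] and
   [F_i], so that [sl2_string] also applies to linear functions on [Z]. *)
Let weight_fun i (a : int) (Psi : Z -> V) : Prop :=
  linear Psi /\ forall z, Psi (actK Z i z) = qd q D i ^ a *: Psi z.

Lemma component_right i : (exists z, Phi z != 0) ->
  coroot i y < (mm i).+1%:Z /\
  (coroot i y + 1 = (mm i).+1%:Z -> forall z, Phi (actF Z i z) = 0).
Proof.
move=> [z1 hz1].
have p0 := qd_neq0 D q_neq0 i.
have sc (Psi : Z -> V) b z : linear Psi -> Psi (b *: z) = b *: Psi z.
  by move=> /scalable_linear ->.
have XE a (Psi : Z -> V) : weight_fun i a Psi -> weight_fun i (a + 2) (precomp (actF Z i) Psi).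
  move=> [lP hP]; split=> [b w z|z]; first by rewrite /precomp /= linearP lP.
  rewrite /precomp /= -[actF Z i _](scalerK (a := q ^ (- (2 * wform (alpha i) (alpha i))))).
    rewrite -actK_F sc // hP -invr_expz invrK qd_double scalerA -expfzDr // addrC //.
  by rewrite expfz_neq0.
have XF a (Psi : Z -> V) : weight_fun i a Psi -> weight_fun i (a - 2) (precomp (actE Z i) Psi).
  move=> [lP hP]; split=> [b w z|z]; first by rewrite /precomp /= linearP lP.
  rewrite /precomp /= -[actE Z i _](scalerK (a := q ^ (2 * wform (alpha i) (alpha i)))).
    by rewrite -actK_E // sc // hP qd_double invr_expz scalerA -expfzDr // addrC.
  by rewrite expfz_neq0.
have XEF a (Psi : Z -> V) : weight_fun i a Psi ->
    precomp (actF Z i) (precomp (actE Z i) Psi) =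
    precomp (actE Z i) (precomp (actF Z i) Psi) + qnum (qd q D i) a *: Psi.
  move=> [lP hP]; apply/funext => z; rewrite /precomp /=.
  have hKV : Psi (actKV Z i z) = qd q D i ^ (- a) *: Psi z.
    rewrite -[in RHS](act_KKV i z) hP scalerA -expfzDr // addNr expr0z scale1r //.
  have := act_EF i i z; rewrite eqxx => /eqP; rewrite subr_eq addrC => /eqP ->.
  rewrite addrC lP addrC; congr (_ + _).
  have -> : Psi (actK Z i z - actKV Z i z) = Psi (actK Z i z) - Psi (actKV Z i z).
    by rewrite (zmod_morphism_linear lP).
  by rewrite hP hKV -scalerBl scalerA qdE mulrC.
have nz : Phi != 0.
  by apply: contra hz1 => /eqP ->.
have wt : weight_fun i (coroot i y) Phi.
  split=> // z; rewrite /Phi wproj_K (wtspace_K _ (wproj_wt y z)) (contractionZ tP cP).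
  by rewrite linearZ /= qd_coroot.
(* [Phi] sees only the component of weight [y]; that of $F_i^kz$ comes from weight $y+k\alpha_i$,
   which is above [mu] for large [k]. *)
have nilp : exists k, iter k (precomp (actF Z i)) Phi = 0.
  exists `|hgt mu - hgt y|.+1%N; apply/funext => z; rewrite iter_precomp /Phi.
  have -> : forall k y, wproj y (iter k (actF Z i) z) =
      iter k (actF Z i) (wproj (y + alpha i *+ k) z).
    elim=> [|k IH] y'; first by rewrite addr0.
    by rewrite iterS wproj_F IH -iterS mulrS addrA.
  rewrite (hw_above q_neq0 hwZ rho_gt0) ?iter_linear0 ?(contraction0 tP cP) ?linear0 //.
  by rewrite wformDl wformMnl; have := rho_gt0 i; nia.
(* This is the leading term of the relation [Eu]. *)
have kill : iter (mm i).+1 (precomp (actE Z i)) Phi = 0.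
  apply/funext => z; rewrite iter_precomp /Phi.
  have -> : forall k y, wproj y (iter k (actE Z i) z) =
      iter k (actE Z i) (wproj (y - alpha i *+ k) z).
    elim=> [|k IH] y'; first by rewrite subr0.
    by rewrite iterS wproj_E IH -iterS mulrS opprD addrA.
  have [_ h] := leading_E i (mm i).+1 hd.
  have [a a0] := h x y _ (wproj_wt (y - alpha i *+ (mm i).+1) z) erefl.
  by rewrite Eu !linear0 => /esym/eqP; rewrite scaler_eq0 (negPf a0) => /eqP.
have [h1 h2] := sl2_string p0 (qd_gen D q_neq0 q_nonroot i) XE XF XEF wt nilp kill nz.
by split=> // /h2 e z; apply: (congr1 (fun Psi : Z -> V => Psi z) e).
Qed.

(** With $\beta=\lambda-x$ and $\gamma=\mu-y$, the bounds from the $sl_2$-strings say that $\beta$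
    and $\gamma$ are nonnegative on all coroots, hence zero on them by the type of [A]. The equality
    cases of the bounds then give $E_i\Phi=0$ and $\Phi F_i=0$. *)
Lemma component_extremal : (exists z, Phi z != 0) -> x = lam /\ y = mu.
Proof.
move=> ex; have [z1 hz1] := ex.
have hz2 : wproj y z1 != 0.
  by apply: contraNneq hz1 => e; rewrite /Phi e (contraction0 tP cP) linear0.
have [c1 e1] := hw_support q_neq0 hwV hz1; have [c2 e2] := hw_support q_neq0 hwZ hz2.
have cx i : coroot i x = (ml i)%:Z - \sum_j A i j *+ c1 j.
  by rewrite e1 corootD corootN coroot_root_sum mlP.
have cy i : coroot i y = (mm i)%:Z - \sum_j A i j *+ c2 j.
  by rewrite e2 corootD corootN coroot_root_sum mmP.
have s1 := cartan_sum_eq0 A_type (c := c1); have s2 := cartan_sum_eq0 A_type (c := c2).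
have {}s1 i : \sum_j A i j *+ c1 j = 0.
  apply: s1 => j; have [h _] := component_left j hz1; rewrite cx in h; lia.
have {}s2 i : \sum_j A i j *+ c2 j = 0.
  apply: s2 => j; have [h _] := component_right j ex; rewrite cy in h; lia.
split; apply/eqP/negPn/negP => ne.
  have /eqP hz1' := hz1; apply: hz1'.
  apply: (hw_singular q_neq0 hwV rho_gt0 irrV (wproj_wt x _)) => // i.
  by have [_ ->] := component_left i hz1 => //; rewrite cx s1; lia.
(* For $y\ne\mu$ all vectors of weight [y] are sums of images of the $F_i$, so [Phi] would
   vanish. *)
have [g [_ e]] := hw_descend q_neq0 hwZ (wproj_wt y z1) ne.
have /eqP hz1' := hz1; apply: hz1'; have -> : Phi z1 = Phi (wproj y z1).
  by rewrite /Phi (wproj_id (wproj_wt _ _)).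
have Phi0 : Phi 0 = 0 by rewrite /Phi linear0 (contraction0 tP cP) linear0.
rewrite e; elim/big_rec: _ => // i z _ IH.
rewrite -[actF Z i _]scale1r Phi_lin IH addr0 scale1r.
by have [_ ->] := component_right i ex => //; rewrite cy s2; lia.
Qed.

End Component.

(** The level rises one by one from a bound given by finite support: a nonzero component on the
    lowest level is extremal by [component_extremal], so its level is already the top. *)
Lemma vanishes_below_total : vanishes_below (hgt lam + hgt mu) u.
Proof.
have [s hs] := contraction_supp gd tP cP u.
have [d0 hd0] : exists d0, forall x y, (x, y) \in s -> d0 <= hgt x + hgt y.
  elim: (s) => [|[x y] s' [d0 IH]]; first by exists 0.
  exists (Num.min d0 (hgt x + hgt y)) => x' y'; rewrite inE => /orP[/eqP[-> ->]|/IH h].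
    by rewrite ge_min lexx orbT.
  by rewrite ge_min h.
have base : vanishes_below d0 u.
  move=> x y z hz lt; rewrite -(wproj_id hz) hs //.
  by apply: contraTN lt => /hd0; rewrite -leNgt.
have step d : d < hgt lam + hgt mu -> vanishes_below d u -> vanishes_below (d + 1) u.
  move=> ld hd x y z hz; rewrite ltzD1 le_eqVlt => /orP[/eqP e|]; last exact: hd.
  apply/eqP/negPn/negP => ne; rewrite -e in hd ld.
  have [|ex ey] := component_extremal hd; last by rewrite ex ey ltxx in ld.
  by exists z; rewrite (wproj_id hz).
have [k hk] : exists k : nat, hgt lam + hgt mu <= d0 + k%:Z.
  by exists (absz (hgt lam + hgt mu - d0)%R); lia.
elim: k d0 base hk {hd0} => [|k IH] d0 base hk.
  by move=> x y z hz lt; apply: (base _ y) => //; move: lt hk; rewrite addr0; lia.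
have [ge|lt] := leP (hgt lam + hgt mu) d0.
  by move=> x y z hz lt; apply: (base _ y) => //; lia.
by apply: (IH (d0 + 1)); [apply: step|lia].
Qed.

(** Both heights are bounded by those of [lam] and [mu], and their sum is not smaller than the
    maximum, so both bounds are attained. *)
Lemma contraction_concentrated x y z :
  wproj x (c (wproj y z) u) != 0 -> x = lam /\ y = mu.
Proof.
move=> ne; have nz : wproj y z != 0.
  by apply: contraNneq ne => ->; rewrite (contraction0 tP cP) linear0.
have [hx ex] := hw_hgt q_neq0 hwV rho_gt0 (wproj_wt x _) ne.
have [hy ey] := hw_hgt q_neq0 hwZ rho_gt0 (wproj_wt y _) nz.
have : ~~ (hgt x + hgt y < hgt lam + hgt mu).
  by apply: contra ne => lt; rewrite (vanishes_below_total (wproj_wt y z) lt).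
by move=> ge; split; [apply: ex|apply: ey]; lia.
Qed.

Variable f : W.
Hypothesis fP : is_lowest_weight_functional mu z0 pair f.

(** The operator [u] only maps weight [mu] to weight [lam]. Both weight spaces are lines, so it is
    fixed by the coefficient [b] of [v0] in its value at [z0]. *)
Lemma singular_vector_unique : exists b, u = b *: t v0 f.
Proof.
have [b eb] := hw_line q_neq0 hwV rho_gt0 (c z0 u); exists b.
apply/eqP; rewrite -subr_eq0; apply/eqP; apply: (contraction_inj gd tP cP) => z.
rewrite linearB linearZ /= cP scalerA mulrC -scalerA -eb.
have csum (s : seq (weight D)) (g : weight D -> Z) :
    c (\sum_(y <- s) g y) u = \sum_(y <- s) c (g y) u.
  elim: s => [|y s IH]; first by rewrite !big_nil (contraction0 tP cP).
  by rewrite !big_cons -[g y]scale1r (contraction_linear tP cP) !scale1r IH.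
have mu_only y : y != mu -> c (wproj y z) u = 0.
  move=> ne; apply/eqP/negPn/negP => /wproj_neq0[x /contraction_concentrated[_ ey]].
  by rewrite ey eqxx in ne.
have at_mu : c (wproj mu z) u = wproj lam (c (wproj mu z) u).
  apply/eqP; rewrite -subr_eq0; apply/negPn/negP => /wproj_neq0[x].
  rewrite linearB /= (wproj_wtspace x (wproj_wt lam _)).
  have [->|ne] := eqVneq x lam; first by rewrite subrr eqxx.
  by rewrite subr0 => /contraction_concentrated[ex]; rewrite ex eqxx in ne.
have -> : (pair f z : L) *: wproj lam (c z0 u) = c (wproj mu z) u.
  by rewrite at_mu fP (contractionZ tP cP) linearZ.
apply/eqP; rewrite subr_eq0; apply/eqP.
have [s [us hs ez]] := wproj_supp z; rewrite [in LHS]ez csum.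
have [mus|mus] := boolP (mu \in s).
  by rewrite (bigD1_seq mu) //= big1 ?addr0.
rewrite (hs _ mus) (contraction0 tP cP) big_seq big1 // => y ys.
by apply: mu_only; apply: contraNneq mus => <-.
Qed.

End LeadingComponent.

(** * The cyclic vector and indecomposability *)

Section Generator.
Variables (L : fieldType) (q : L) (n : nat) (A : 'M[int]_n) (D : weight_data A).
Hypotheses (q_neq0 : q != 0) (q_nonroot : forall k, (0 < k)%N -> q ^+ k != 1).
Variables (V Z : weight_module q D) (W U : Uq_module q D).
Variables (pair : {bilinear W -> Z -> L^o}) (t : {bilinear V -> W -> U}).
Hypotheses (gd : is_graded_dual pair) (tP : is_tensor_module t).
Variable rho : weight D.
Hypothesis rho_gt0 : forall i, 0 < wform (simple_root D i) rho.
Variables (lam mu : weight D) (v0 : V) (z0 : Z).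
Hypotheses (hwV : is_highest_weight_vector lam v0) (hwZ : is_highest_weight_vector mu z0).
Hypotheses (irrV : irreducible V) (irrZ : irreducible Z).
Variable f : W.
Hypothesis fP : is_lowest_weight_functional mu z0 pair f.

Lemma generator_F v i : exists2 a : L, a != 0 & actF U i (t v f) = a *: t (actF V i v) f.
Proof.
exists (q ^ (2 * wform (simple_root D i) mu)); first exact: expfz_neq0.
rewrite (tensor_F tP) (lowest_F q_neq0 hwZ rho_gt0 gd fP) linear0r addr0.
by rewrite (lowest_KV hwZ gd fP) linearZr_LR.
Qed.

Lemma generator_iter_F i m : coroot i lam = m%:Z -> iter m.+1 (actF U i) (t v0 f) = 0.
Proof.
move=> hm; have [a ->] : exists a : L, iter m.+1 (actF U i) (t v0 f) =
    a *: t (iter m.+1 (actF V i) v0) f.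
  elim: m.+1 => [|k [a e]]; first by exists 1; rewrite scale1r.
  have [b _ eb] := generator_F (iter k (actF V i) v0) i.
  by exists (a * b); rewrite iterS e linearZ /= eb scalerA.
by rewrite (hw_integrable q_neq0 q_nonroot hwV rho_gt0 irrV hm) linear0l scaler0.
Qed.

Lemma generator_iter_E i m : coroot i mu = m%:Z -> iter m.+1 (actE U i) (t v0 f) = 0.
Proof.
move=> hm; have [a ->] : exists a : L, iter m.+1 (actE U i) (t v0 f) =
    a *: t v0 (iter m.+1 (actE W i) f).
  elim: m.+1 => [|k [a e]]; first by exists 1; rewrite scale1r.
  exists (a * q ^ (2 * wform (simple_root D i) lam)).
  rewrite iterS e linearZ /= (tensor_E tP) (hw_E hwV) linear0l add0r.
  by rewrite (wtspace_K _ (hw_weight hwV)) linearZl_LR scalerA.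
by rewrite (lowest_integrable q_neq0 q_nonroot hwZ rho_gt0 gd fP irrZ hm) linear0r scaler0.
Qed.

(* First [t v f] for all [v], because [F_i] kills [f]; then all [t v h],
   applying [E_i] to [t v h] with [K_i] invertible on [V]. *)
Lemma generator_generates (S : U -> Prop) : Uq_submodule S -> S (t v0 f) -> forall u, S u.
Proof.
move=> [S0 Sl SE SF SK SKV] Su0.
have SZ a u : S u -> S (a *: u) by move=> h; rewrite -[_ *: _]addr0; apply: Sl.
have Svf v : S (t v f).
  elim/(hw_ind q_neq0 hwV): v => [||a u v hu hv|i v hv] //.
  - by rewrite linear0l.
  - by rewrite linearPl; apply: Sl.
  have [a a0 e] := generator_F v i.
  by rewrite -[t _ _](scalerK a0) -e; apply/SZ/SF.
have Svh h : forall v, S (t v h).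
  elim/(lowest_ind q_neq0 hwZ rho_gt0 gd fP irrZ): h => [//|v|a g h hg hh v|i h hh v].
  - by rewrite linear0r.
  - by rewrite linearPr; apply: Sl.
  have := tensor_E tP i (actKV V i v) h; rewrite act_KKV addrC => /eqP.
  rewrite -subr_eq => /eqP <-; rewrite addrC -scaleN1r; apply: Sl => //.
  exact: SE.
by move=> u; apply: (tensor_ind tP).
Qed.

Variable c : Z -> {linear U -> V}.
Hypothesis cP : forall z v f, c z (t v f) = (pair f z : L) *: v.

Lemma generator_neq0 : t v0 f != 0.
Proof.
apply/eqP => /(congr1 (c z0)); rewrite cP (lowest_v0 hwZ fP) scale1r linear0.
exact/eqP/(hw_neq0 hwV).
Qed.

(** Contraction with a suitable [z], then raising operators, then the coordinate along [v0]. These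
    functionals are needed to compare coefficients after extension of scalars. *)
Lemma tensor_functional (u : U) : u != 0 -> exists psi : {linear U -> L^o}, psi u != 0.
Proof.
move=> u0; have [z cz] : exists z, c z u != 0.
  apply: contrapT => no; case/eqP: u0; apply: (contraction_inj gd tP cP) => z.
  by apply/eqP/negPn/negP => h; apply: no; exists z.
have [w hw] := hw_separate q_neq0 hwV rho_gt0 irrV cz.
have [phi phiP] := hw_functional q_neq0 hwV rho_gt0.
have [T TP] : exists T : {linear V -> V}, forall v, T v = foldr (fun i => actE V i) v w.
  elim: (w) => [|i s [T TP]]; first by exists (idfun : {linear V -> V}).
  by exists (actE V i \o T : {linear V -> V}) => v /=; rewrite TP.
exists (phi \o (T \o c z) : {linear U -> L^o}); apply: contraNneq hw => /= e.
by rewrite -TP phiP e scale0r.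
Qed.

End Generator.

(** * Modules generated by a vector unique up to scalars *)

Section CyclicCriterion.
Variables (K : fieldType) (q : K) (n : nat) (A : 'M[int]_n) (D : weight_data A).
Variables (U : Uq_module q D) (u0 : U) (ml mm : 'I_n -> nat).

(** Field and module are arguments because the condition is also used after extension of scalars. *)
Definition killed (K' : fieldType) (q' : K') (M : Uq_module q' D) (u : M) : Prop :=
  (forall i, iter (ml i).+1 (actF M i) u = 0) /\ (forall i, iter (mm i).+1 (actE M i) u = 0).

Hypothesis u0_neq0 : u0 != 0.
Hypothesis u0_killed : killed u0.
Hypothesis killed_line : forall u : U, killed u -> exists b, u = b *: u0.
Hypothesis u0_gen : forall S : U -> Prop, Uq_submodule S -> S u0 -> forall u, S u.
Hypothesis functionals : forall u : U, u != 0 -> exists psi : {linear U -> K^o}, psi u != 0.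

Definition scalar_endo (a : K) : UqEnd U := a *: UqEnd_id U.

Lemma scalar_endo_apply a u : scalar_endo a u = a *: u.
Proof. by []. Qed.

(** The image of [u0] is killed, hence equals [a *: u0]; the vectors on which [g] acts by [a] form a
    submodule containing [u0]. *)
Lemma UqEnd_scalar (g : UqEnd U) : exists a, g = scalar_endo a.
Proof.
have /Uq_endoP[lg cg] := valP g.
have [h hg] : exists h : {linear U -> U}, forall u, h u = g u.
  by exists (HB.pack_for {linear U -> U} (val g) (GRing.isLinear.Build K U U *:%R (val g) lg)).
have hE i u : h (actE U i u) = actE U i (h u) by rewrite !hg; have [] := cg i u.
have hF i u : h (actF U i u) = actF U i (h u) by rewrite !hg; have [] := cg i u.
have hK i u : h (actK U i u) = actK U i (h u) by rewrite !hg; have [] := cg i u.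
have hKV i u : h (actKV U i u) = actKV U i (h u) by rewrite !hg; have [] := cg i u.
have [|a ea] := killed_line (u := h u0).
  have [kF kE] := u0_killed; split=> i.
    have -> : forall k, iter k (actF U i) (h u0) = h (iter k (actF U i) u0).
      by elim=> //= k ->; rewrite hF.
    by rewrite kF linear0.
  have -> : forall k, iter k (actE U i) (h u0) = h (iter k (actE U i) u0).
    by elim=> //= k ->; rewrite hE.
  by rewrite kE linear0.
exists a; apply: val_inj; apply/funext => u; rewrite -[RHS]/(a *: u) -[LHS]/(g u) -hg.
apply: (u0_gen (S := fun u => h u = a *: u)) ea _.
split=> [|b u1 u2 e1 e2|i v e|i v e|i v e|i v e].
- by rewrite !linear0.
- by rewrite linearP e1 e2 scalerDr !scalerA mulrC.
- by rewrite hE e linearZ.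
- by rewrite hF e linearZ.
- by rewrite hK e linearZ.
- by rewrite hKV e linearZ.
Qed.

Lemma scalar_endo_is_zmod_morphism : zmod_morphism scalar_endo.
Proof. by move=> a b; rewrite /scalar_endo scalerBl. Qed.

Lemma scalar_endo_is_monoid_morphism : monoid_morphism scalar_endo.
Proof.
split; first by rewrite /scalar_endo scale1r.
by move=> a b; apply: val_inj; apply/funext => u; rewrite /scalar_endo -scalerA.
Qed.

HB.instance Definition _ :=
  GRing.isZmodMorphism.Build K (UqEnd U) scalar_endo scalar_endo_is_zmod_morphism.
HB.instance Definition _ :=
  GRing.isMonoidMorphism.Build K (UqEnd U) scalar_endo scalar_endo_is_monoid_morphism.

Lemma UqEnd_is_base_field : exists h : {rmorphism K -> UqEnd U},
  bijective h /\ forall a b : K, h (a * b) = a *: h b.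
Proof.
exists scalar_endo; split=> [|a b]; last by rewrite /scalar_endo scalerA.
pose inv g := sval (cid (UqEnd_scalar g)).
have invP g : g = scalar_endo (inv g) := svalP (cid (UqEnd_scalar g)).
exists inv => [a|g]; last exact: esym (invP g).
have : scalar_endo (inv (scalar_endo a)) u0 = scalar_endo a u0 by rewrite -invP.
rewrite !scalar_endo_apply => /eqP; rewrite -subr_eq0 -scalerBl scaler_eq0.
by rewrite (negPf u0_neq0) orbF subr_eq0 => /eqP.
Qed.

(** * Extension of the base field *)

Section Extension.
Variables (L : fieldType) (phi : {rmorphism K -> L}) (X : Uq_module (phi q) D).
Variable iota : {linear U -> X | phi \; *:%R}.
Hypothesis eP : is_scalar_extension iota.

Definition independent_over_base m (l : 'I_m -> L) : Prop :=
  forall a : 'I_m -> K, \sum_j phi (a j) * l j = 0 -> forall j, a j = 0.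

Lemma extension_repr (x : X) : exists m (l : 'I_m -> L) (u : 'I_m -> U),
  x = \sum_j l j *: iota (u j).
Proof.
pose S x := exists m (l : 'I_m -> L) (u : 'I_m -> U), x = \sum_j l j *: iota (u j).
have S0 : S 0.
  by exists 0%N, (fun _ => 0), (fun _ => 0); rewrite big_ord0.
have Sl a y z : S y -> S z -> S (a *: y + z).
  move=> [m1 [l1 [u1 ->]]] [m2 [l2 [u2 ->]]].
  exists (m1 + m2)%N,
    (fun j : 'I_(m1 + m2) => match fintype.split j with inl i => a * l1 i | inr i => l2 i end),
    (fun j : 'I_(m1 + m2) => match fintype.split j with inl i => u1 i | inr i => u2 i end).
  rewrite big_split_ord scaler_sumr; congr (_ + _); apply: eq_bigr => j _ /=.
    case: fintype.splitP => [i /= /ord_inj <-|k e]; first by rewrite scalerA.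
    by move: (ltn_ord j) e => /= + e; rewrite e ltnNge leq_addr.
  case: fintype.splitP => [i e|k /= /eqP]; first by move: (ltn_ord i) e => + /= e; rewrite -e ltnNge leq_addr.
  by rewrite eqn_add2l => /eqP/ord_inj ->.
have hS v : S (iota v).
  by exists 1%N, (fun _ => 1), (fun _ => v); rewrite big_ord1 scale1r.
exact: (extension_subspace_full eP (S := Subspace S0 Sl) hS).
Qed.

(** Induction on the number of terms: a relation with nonzero coefficient at [k] expresses [l k]
    through the other scalars, and its term is absorbed into their vectors. *)
Lemma extension_repr_independent (x : X) : exists m (l : 'I_m -> L) (u : 'I_m -> U),
  independent_over_base l /\ x = \sum_j l j *: iota (u j).
Proof.
have [m [l [u e]]] := extension_repr x.
elim: m l u e => [|m IH] l u e; first by exists 0%N, l, u; split=> // a _ [].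
have [ind|] := pselect (independent_over_base l); first by exists m.+1, l, u.
move=> /existsNP[a /not_implyP[sa /existsNP[k /eqP ak]]].
apply: (IH (fun j => l (lift k j)) (fun j => u (lift k j) - (a (lift k j) / a k) *: u k)).
rewrite e (bigD1_ord k) //=.
have pk : phi (a k) != 0 by rewrite fmorph_eq0.
have -> : l k = - \sum_(j < m) phi (a (lift k j) / a k) * l (lift k j).
  move: sa; rewrite (bigD1_ord k) //= => /eqP; rewrite addr_eq0 => /eqP sa.
  apply: (mulfI pk); rewrite sa mulrN mulr_sumr; congr (- _); apply: eq_bigr => j _.
  by rewrite mulrA -rmorphM [a k * _]mulrC divfK.
rewrite scaleNr scaler_suml -sumrN -big_split; apply: eq_bigr => j _ /=.
rewrite linearB [iota (_ *: u k)]linearZ /= scalerBr [LHS]addrC ?scalerN ?scaleNr; congr (_ - _).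
by rewrite scalerA mulrC.
Qed.

(** A functional [psi] on [U] extends to [X] by the universal property; applied to the sum it gives
    a relation among the [l j] with coefficients [psi (u j)], which must vanish. *)
Lemma extension_free m (l : 'I_m -> L) (u : 'I_m -> U) : independent_over_base l ->
  \sum_j l j *: iota (u j) = 0 -> forall j, u j = 0.
Proof.
move=> ind e j; apply/eqP/negPn/negP => /functionals[psi].
have lin : GRing.linear_for (phi \; *:%R : K -> L^o -> L^o) (fun u => phi (psi u) : L^o).
  by move=> a v w /=; rewrite linearP rmorphD rmorphM.
pose F := HB.pack_for {linear U -> L^o | phi \; *:%R} (fun u => phi (psi u) : L^o)
  (GRing.isLinear.Build K U L^o (phi \; *:%R) _ lin).
have [g [gP _]] := ext_universal eP F.
rewrite (ind (fun j => psi (u j))) ?eqxx //.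
have := congr1 g e; rewrite linear_sum linear0 => e'; rewrite -[RHS]e'.
by apply: eq_bigr => k _; rewrite linearZ /= gP mulrC.
Qed.

Lemma extension_killed_line (x : X) : killed x -> exists b, x = b *: iota u0.
Proof.
have [m [l [u [ind ->]]]] := extension_repr_independent x; move=> [kF kE].
have itF i k : iter k (actF X i) (\sum_j l j *: iota (u j)) =
    \sum_j l j *: iota (iter k (actF U i) (u j)).
  elim: k => //= k ->; rewrite linear_sum; apply: eq_bigr => j _.
  by rewrite linearZ /= (ext_F eP).
have itE i k : iter k (actE X i) (\sum_j l j *: iota (u j)) =
    \sum_j l j *: iota (iter k (actE U i) (u j)).
  elim: k => //= k ->; rewrite linear_sum; apply: eq_bigr => j _.
  by rewrite linearZ /= (ext_E eP).
have kl j : exists b, u j = b *: u0.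
  apply: killed_line; split=> i.
    apply: (extension_free (u := fun j => iter (ml i).+1 (actF U i) (u j)) ind).
    by rewrite -itF.
  apply: (extension_free (u := fun j => iter (mm i).+1 (actE U i) (u j)) ind).
  by rewrite -itE.
exists (\sum_j l j * phi (sval (cid (kl j)))); rewrite scaler_suml; apply: eq_bigr => j _.
by rewrite {1}(svalP (cid (kl j))) linearZ /= scalerA.
Qed.

Lemma extension_generates (S : X -> Prop) : Uq_submodule S -> S (iota u0) -> forall x, S x.
Proof.
move=> [S0 Sl SE SF SK SKV] Su0.
have hS : Uq_submodule (fun u => S (iota u)).
  split=> [|a u v hu hv|i v hv|i v hv|i v hv|i v hv].
  - by rewrite linear0.
  - by rewrite linearP; apply: Sl.
  - by rewrite -(ext_E eP); apply: SE.
  - by rewrite -(ext_F eP); apply: SF.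
  - by rewrite -(ext_K eP); apply: SK.
  by rewrite -[iota _](act_KVK i) (ext_K eP) act_KKV; apply: SKV.
exact: (extension_subspace_full eP (S := Subspace S0 Sl) (u0_gen hS Su0)).
Qed.

(** Split [iota u0] along the two summands. Its first part is killed, hence a multiple
    [b *: iota u0]; for [b = 0] the generator lies in [S2], otherwise in [S1], and the other summand
    is zero. *)
Lemma extension_indecomposable : indecomposable X.
Proof.
have iu0 : iota u0 != 0.
  apply/eqP => e; case/eqP: u0_neq0.
  apply: (extension_free (m := 1) (l := fun _ => 1) (u := fun _ => u0)) ord0.
    move=> a; rewrite big_ord1 mulr1 => /eqP; rewrite fmorph_eq0 => /eqP h j.
    by rewrite ord1.
  by rewrite big_ord1 e scaler0.
split; first by exists (iota u0).
move=> S1 S2 h1 h2 dis sum; have [v1 [v2 [Sv1 Sv2 e]]] := sum (iota u0).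
have iterS (S : X -> Prop) (T : X -> X) k v : (forall w, S w -> S (T w)) -> S v -> S (iter k T v).
  by move=> hT hv; elim: k => //= k; apply: hT.
have iterD (T : {linear X -> X}) k : iter k T v1 + iter k T v2 = iter k T (iota u0).
  by elim: k => [|k IH] /=; rewrite -?IH ?linearD.
have kill (T : {linear X -> X}) k : (forall w, S1 w -> S1 (T w)) -> (forall w, S2 w -> S2 (T w)) ->
    iter k T (iota u0) = 0 -> iter k T v1 = 0.
  (* Here $T^kv_1=-T^kv_2$ lies in both summands. *)
  move=> hT1 hT2; rewrite -iterD => /eqP; rewrite addr_eq0 => /eqP e1.
  apply: dis; first exact: iterS.
  rewrite e1 -scaleN1r -[_ *: _]addr0.
  by apply: (sub_lin h2); [apply: iterS|apply: sub_0 h2].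
have [kF kE] := u0_killed.
have [b eb] : exists b, v1 = b *: iota u0.
  apply: extension_killed_line; split=> i; apply: kill.
  - exact: sub_F.
  - exact: sub_F.
  - have -> : forall k, iter k (actF X i) (iota u0) = iota (iter k (actF U i) u0).
      by elim=> //= k ->; rewrite (ext_F eP).
    by rewrite kF linear0.
  - exact: sub_E.
  - exact: sub_E.
  have -> : forall k, iter k (actE X i) (iota u0) = iota (iter k (actE U i) u0).
    by elim=> //= k ->; rewrite (ext_E eP).
  by rewrite kE linear0.
have [b0|b0] := eqVneq b 0.
  left=> v Sv; apply: dis => //; apply: extension_generates => //.
  by rewrite e eb b0 scale0r add0r.
right=> v Sv; apply: dis => //; apply: extension_generates => //.
rewrite -[iota u0](scalerK b0) -eb -[_ *: _]addr0.
by apply: (sub_lin h1) => //; apply: sub_0 h1.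
Qed.

End Extension.

End CyclicCriterion.

(** * The generic parameter and the conclusion *)

Lemma q_gen_neq0 : q_gen != 0.
Proof. by rewrite /q_gen tofrac_eq0 polyX_eq0. Qed.

Lemma q_gen_not_root_of_unity k : (0 < k)%N -> q_gen ^+ k != 1.
Proof.
move=> k0; rewrite /q_gen -tofracXn -tofrac1 tofrac_eq.
by apply/eqP => /(congr1 (fun p : {poly rat} => size p)); rewrite size_polyXn size_poly1; case: k k0.
Qed.

Theorem theorem2p2 (n : nat) (A : 'M[int]_n)
  (A_gcm : is_GCM A) (A_type : affine_type A \/ indefinite_type A)
  (D : weight_data A)
  (lambda mu : weight D) (lambda_dom : dominant lambda) (mu_dom : dominant mu)
  (Llambda Lmu : weight_module q_gen D)
  (Llambda_hw : is_irreducible_highest_weight lambda Llambda)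
  (Lmu_hw : is_irreducible_highest_weight mu Lmu)
  (Lmu_dual : Uq_module q_gen D)
  (pair : {bilinear Lmu_dual -> Lmu -> Qq^o})
  (Lmu_dualP : is_graded_dual pair)
  (U : Uq_module q_gen D)
  (t : {bilinear Llambda -> Lmu_dual -> U})
  (UP : is_tensor_module t) :
  (exists h : {rmorphism Qq -> UqEnd U},
     bijective h /\ forall a b : Qq, h (a * b) = a *: h b) /\
  absolutely_indecomposable U.
Proof.
have q0 := q_gen_neq0; have qg := q_gen_not_root_of_unity.
have [[v0 hwV] irrV] := Llambda_hw; have [[z0 hwZ] irrZ] := Lmu_hw.
have [rho rho_gt0] := exists_height D.
have [f fP] := lowest_weight_functional_exists q0 hwZ rho_gt0 Lmu_dualP.
have [c cP] := contraction_exists pair UP.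
(* By dominance these are the values $\langle\lambda,\alpha_i^\vee\rangle$ and
   $\langle\mu,\alpha_i^\vee\rangle$ themselves. *)
pose ml i := absz (coroot i lambda); pose mm i := absz (coroot i mu).
have mlP i : coroot i lambda = (ml i)%:Z by rewrite gez0_abs // dominant_coroot.
have mmP i : coroot i mu = (mm i)%:Z by rewrite gez0_abs // dominant_coroot.
have u0_neq0 := generator_neq0 hwV hwZ fP cP.
have u0_killed : killed ml mm (t v0 f).
  split=> i; first exact: (generator_iter_F q0 qg Lmu_dualP UP rho_gt0 hwV hwZ irrV fP (mlP i)).
  exact: (generator_iter_E q0 qg Lmu_dualP UP rho_gt0 hwV hwZ irrZ fP (mmP i)).
have line u : killed ml mm u -> exists b, u = b *: t v0 f.
  move=> [Fu Eu].
  exact: (singular_vector_unique q0 qg Lmu_dualP UP rho_gt0 cP hwV hwZ irrV A_type mlP mmP Fu Eu fP).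
have gen := generator_generates q0 Lmu_dualP UP rho_gt0 hwV hwZ irrZ fP.
have sep := tensor_functional q0 Lmu_dualP UP rho_gt0 hwV irrV cP.
split; first exact: (UqEnd_is_base_field u0_neq0 u0_killed line gen).
move=> L phi X iota eP.
exact: (extension_indecomposable u0_neq0 u0_killed line gen sep eP).
Qed.
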